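(* Put $t=\frac{1}{2\sqrt{x}}$. (i) For any $k\ge 4$, $$H_{[k,1]}(x)=\frac{1}{4t^2U_k^2(t)}\left(\sum_{j=1}^{k-2}U_j^2(t)-1\right);$$ besides, $$H_{[3,1]}(x)=\frac{x^3}{1-2x}.$$ (ii) For any $k\ge 5$, $$H_{[k,2]}(x)=\frac{1}{4t^2U_k^2(t)}\left(\sum_{j=1}^{k-2}U_j^2(t)-\frac{2tU_{k-3}(t)}{U_{k-2}(t)}-2\right);$$ besides, $$H_{[4,2]}(x)=\frac{x^3(1+x)}{(1-x)(1-3x+x^2)}.$$ (iii) For any $k\ge 6$ and any $m$ with $3\le m\le k/2$, $$H_{[k,m]}(x)=\frac{1}{4t^2U_k^2(t)}\left(\sum_{j=1}^{k-m-2}U_j^2(t)+\sum_{j=1}^{m-1}U_j^2(t)-1+U_{k-1}(t)U_{m-1}(t)U_{k-m-2}(t)\right).$$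
   Context: $\mathfrak{S}_n$ is the set of permutations of $\{1,\dots,n\}$ in one-line notation. An occurrence of a pattern $\tau\in\mathfrak{S}_k$ in $\pi\in\mathfrak{S}_n$ is a subsequence $(\pi_{i_1},\dots,\pi_{i_k})$ with $i_1<\dots<i_k$ that is order-isomorphic to $\tau$; $\pi$ avoids $\tau$ if there is no occurrence of $\tau$ in $\pi$, and contains $\tau$ exactly once if there is exactly one occurrence. For $1\le m\le k-1$, $[k,m]$ denotes the pattern $(m+1,m+2,\dots,k,1,2,\dots,m)\in\mathfrak{S}_k$. $H_\tau(x)=\sum_{n\ge 0}h_\tau(n)x^n$, where $h_\tau(n)$ is the number of permutations in $\mathfrak{S}_n$ that avoid $\tau$ and contain $132$ exactly once. $U_r$ is the Chebyshev polynomial of the second kind, $U_r(\cos\theta)=\frac{\sin (r+1)\theta}{\sin\theta}$, equivalently $U_0(y)=1$, $U_1(y)=2y$, $U_r(y)=2yU_{r-1}(y)-U_{r-2}(y)$. With $t=\frac{1}{2\sqrt x}$ the right-hand sides are rational functions of $x$, and the identities are identities of formal power series in $x$. *)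

(* Defs.v *)
From HB Require Import structures.
From mathcomp Require Import all_boot all_order all_fingroup all_algebra.

Set Implicit Arguments.
Unset Strict Implicit.
Unset Printing Implicit Defensive.

Import GRing.Theory.

(* A permutation of {1, ..., n} is an element of 'S_n, with positions and
   values shifted down to {0, ..., n-1}. *)

(* The entries of a permutation are distinct, so a subsequence is the same
   thing as its set of positions f 0 < ... < f (k-1). *)
Definition occurrence (k n : nat) (tau : 'S_k) (pi : 'S_n)
    (f : {ffun 'I_k -> 'I_n}) : bool :=
  [forall a : 'I_k, forall b : 'I_k, (a < b) ==> (f a < f b)] &&
  [forall a : 'I_k, forall b : 'I_k,
     (tau a < tau b) == (pi (f a) < pi (f b))].

Definition occurrences (k n : nat) (tau : 'S_k) (pi : 'S_n) :
    {set {ffun 'I_k -> 'I_n}} :=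
  [set f | occurrence tau pi f].

Definition avoids (k n : nat) (tau : 'S_k) (pi : 'S_n) : bool :=
  occurrences tau pi == set0.

Definition contains_once (k n : nat) (tau : 'S_k) (pi : 'S_n) : bool :=
  #|occurrences tau pi| == 1.

(* 132 is the identity with its last two entries exchanged. *)
Definition p132 : 'S_3 := tperm (@Ordinal 3 1 isT) (@Ordinal 3 2 isT).

Definition shift_ord (k m : nat) (i : 'I_k) : 'I_k :=
  Ordinal (ltn_pmod (i + m) (leq_ltn_trans (leq0n i) (ltn_ord i))).

Lemma shift_ord_inj (k m : nat) : injective (@shift_ord k m).
Proof.
move=> i j [] /eqP; rewrite eqn_modDr => /eqP.
by rewrite !modn_small // => /val_inj.
Qed.

(* The pattern [k,m] = (m+1, ..., k, 1, ..., m); see shift_pattern_one_line. *)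
Definition shift_pattern (k m : nat) : 'S_k := perm (@shift_ord_inj k m).

Lemma shift_pattern_one_line (k m : nat) : m <= k ->
  [seq (shift_pattern k m i).+1 | i <- enum 'I_k] =
  iota m.+1 (k - m) ++ iota 1 m.
Proof.
move=> le_mk; apply: (@eq_from_nth _ 0) => [|i].
  by rewrite size_map size_cat !size_iota size_enum_ord subnK.
rewrite size_map size_enum_ord => lt_ik.
rewrite (nth_map (Ordinal lt_ik)) ?size_enum_ord //.
rewrite permE /= nth_enum_ord // nth_cat size_iota.
have [lt_ikm|le_kmi] := ltnP i (k - m).
  rewrite nth_iota // modn_small ?addSn 1?addnC //.
  by rewrite -(subnKC le_mk) ltn_add2l.
have le_kim : k <= i + m by rewrite -(subnK le_mk) leq_add2r.
have lt_ikm : i + m - k < m by rewrite ltn_subLR // ltn_add2r.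
rewrite (_ : i - (k - m) = i + m - k) ?subnBA // nth_iota // add1n.
by rewrite -{1}(subnK le_kim) modnDr modn_small // (leq_trans lt_ikm).
Qed.

(* The coefficient h_tau(n) of H_tau(x). *)
Definition h (k : nat) (tau : 'S_k) (n : nat) : nat :=
  #|[set pi : 'S_n | avoids tau pi && contains_once p132 pi]|.

Local Open Scope ring_scope.

Fixpoint chebU (R : comNzRingType) (r : nat) (y : R) : R :=
  match r with
  | 0%N => 1
  | 1%N => 2 * y
  | (r'.+1 as r1).+1 => 2 * y * chebU r1 y - chebU r' y
  end.

(* The right-hand sides are computed in the field Q(s), where s = sqrt x. *)
Definition sqrtx : {fraction {poly rat}} := tofrac 'X.
Definition x : {fraction {poly rat}} := sqrtx ^+ 2.
Definition t : {fraction {poly rat}} := (2 * sqrtx)^-1.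

(* F in Q(s) is a rational function p(x)/q(x) of x = s^2, and
   \sum_n a_n x^n = p(x)/q(x) as formal power series in x, i.e.
   q(x) * \sum_n a_n x^n = p(x). *)
Definition is_gf (a : nat -> nat) (F : {fraction {poly rat}}) : Prop :=
  exists p q : {poly rat},
    [/\ q != 0,
        F = tofrac (p \Po 'X^2) / tofrac (q \Po 'X^2) &
        forall n : nat, \sum_(i < n.+1) q`_i * (a (n - i)%N)%:R = p`_n].

(* Main.v *)
Require Import Defs.
From HB Require Import structures.
From mathcomp Require Import all_boot all_order all_fingroup all_algebra.
From mathcomp Require Import zify ring boolp.

Set Implicit Arguments.
Unset Strict Implicit.
Unset Printing Implicit Defensive.

Import GRing.Theory.

(* Split a permutation at its maximum n, as l ++ n :: r. If it contains 132 at
   most once, then either every entry of l exceeds every entry of r, and the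
   occurrences of 132 lie inside l or inside r; or n is the 3 of the unique
   occurrence, l and r avoid 132, l ends with its minimum a, and the only entry
   of r above a is a + 1. An occurrence of [k,m] is an increasing sequence of
   length k - m followed by a lower increasing sequence of length m, so whether
   the whole contains one is decided by patterns of the same kind in l and r.
   This gives linear equations for the generating functions, which the Chebyshev
   recurrence solves. *)

(** * Occurrences of 132 *)

(** The obstacle is the exceptional case, where the word reads [l, x, n, r] and [b] is the one entry
    of [r] above [x]. Compared with the case where [l] exceeds [r], two ascents are new, [x n] and
    [x b], and neither extends to length three. They affect avoidance only by filling a whole block
    of the pattern: the lower one if [m = 2], the upper one if [k - m = 2]. Hence [m = 2] has its
    own formula and [[3,1]], [[4,2]] are computed apart, while all other block lengths share one
    equation. Avoidance is not a product of conditions on the two sides, but it is a sum of two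
    products once one splits on whether the left side contains a long enough increasing sequence.
    Denominators are avoided by scaling [U_n(t)] to [cheb n], a polynomial in [x] with constant term
    1: equations are multiplied by values of [cheb] and stay among power series. As [cheb] makes
    sense over any commutative ring, the same polynomials are read as power series on one side and
    in [Q(s)] on the other. *)

Fixpoint inversions (s : seq nat) : nat :=
  if s is a :: s' then count (fun b => b < a) s' + inversions s' else 0.

Fixpoint n132 (s : seq nat) : nat :=
  if s is a :: s' then inversions [seq b <- s' | a < b] + n132 s' else 0.

Lemma inversions_cat (u v : seq nat) :
  inversions (u ++ v) =
  inversions u + inversions v + \sum_(a <- u) count (fun b => b < a) v.
Proof.
elim: u => [|a u IHu] /=; first by rewrite big_nil addn0.
by rewrite big_cons count_cat IHu; lia.
Qed.

Lemma n132_catr (u v : seq nat) : n132 v <= n132 (u ++ v).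
Proof. by elim: u => //= a u IHu; rewrite (leq_trans IHu) ?leq_addl. Qed.

(** An occurrence starting in [l] cannot reach into [r]: the only larger entry there is [n], which
    exceeds all of [l], so it cannot be the 2 after a 3 from [l], and one entry cannot be both 3 and
    2. The suffix is kept general to serve for [n :: r] and for a suffix with one more entry before
    the maximum. *)
Lemma n132_cat (n : nat) (l r : seq nat) :
  (forall a, a \in l -> a < n /\ [seq b <- r | a < b] = [:: n]) ->
  n132 (l ++ r) = n132 l + n132 r.
Proof.
elim: l => //= a l IHl nmax; rewrite IHl; last first.
  by move=> c cl; apply: nmax; rewrite inE cl orbT.
rewrite filter_cat inversions_cat.
have [an ->] := nmax a (mem_head _ _).
rewrite big1_seq ?addn0 ?addnA //= => c; rewrite mem_filter => /andP[_ cl].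
have [|cn _] := nmax c; first by rewrite inE cl orbT.
by rewrite ltnNge ltnW.
Qed.

(** Each ascending pair [a < b] across the maximum gives an occurrence [a n b], distinct from those
    inside [l] or [r]. *)
Lemma n132_cat_ge (n : nat) (l r : seq nat) :
  {in l, forall a, a < n} -> {in r, forall a, a < n} ->
  n132 l + n132 r + \sum_(a <- l) count (fun b => a < b) r <= n132 (l ++ n :: r).
Proof.
move=> ln rn; elim: l ln => [|a l IHl] ln /=; first by rewrite big_nil addn0 leq_addl.
rewrite big_cons filter_cat inversions_cat /= (ln a (mem_head _ _)) /=.
have /IHl : {in l, forall a, a < n} by move=> b bl; rewrite ln // inE bl orbT.
have : count (fun b => a < b) r =
  count (fun b => b < n) [seq b <- r | a < b].
  rewrite count_filter; apply: eq_in_count => b br /=.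
  by rewrite rn.
lia.
Qed.

Lemma n132_map (f : nat -> nat) (s : seq nat) :
  {mono f : a b / a < b} -> n132 (map f s) = n132 s.
Proof.
move=> fmono; elim: s => //= a s ->; congr (_ + _).
rewrite filter_map -(@eq_filter _ (fun b => a < b)); last by move=> b /=; rewrite fmono.
elim: [seq b <- s | a < b] => //= b u ->; rewrite count_map.
by congr (_ + _); apply: eq_count => c /=; rewrite fmono.
Qed.

Lemma splitr_mem (T : eqType) (x : T) (s : seq T) :
  x \in s -> exists s1 s2, s = s1 ++ x :: s2.
Proof. by case/splitPr=> s1 s2; exists s1, s2. Qed.

Lemma allrelPn (T : eqType) (r : rel T) (s1 s2 : seq T) :
  ~~ allrel r s1 s2 -> exists a b, [/\ a \in s1, b \in s2 & ~~ r a b].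
Proof.
rewrite /allrel -has_predC => /hasP[a al /=]; rewrite -has_predC => /hasP[b br nr].
by exists a, b.
Qed.

(** By [n132_cat_ge] at most one pair [a < b] ascends from [l] to [r], and if there is one, it uses
    up the only occurrence allowed. All other entries of [l] then exceed [r], and all other entries
    of [r] lie below [a]. *)
Lemma n132_split (n : nat) (l r : seq nat) :
  {in l, forall a, a < n} -> {in r, forall a, a < n} -> uniq (l ++ r) ->
  n132 (l ++ n :: r) <= 1 ->
  (allrel (fun a b => b < a) l r /\ n132 (l ++ n :: r) = n132 l + n132 r) \/
  (n132 (l ++ n :: r) = 1 /\ n132 l = 0 /\ n132 r = 0 /\
   exists l1 a r1 b r2, [/\ l = rcons l1 a, r = r1 ++ b :: r2,
     allrel (fun a b => b < a) l1 (a :: r),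
     a < b & {in r1 ++ r2, forall c, c < a}]).
Proof.
move=> ln rn lr_uniq le1.
have [desc|] := boolP (allrel (fun a b => b < a) l r).
  left; split=> //; rewrite (@n132_cat n) /= => [|a al].
    rewrite (_ : [seq b <- r | n < b] = [::]) //.
    apply/eqP; rewrite -(negbK (_ == _)) -has_filter; apply/hasPn=> b /rn.
    by rewrite -leqNgt => /ltnW.
  split; first exact: ln.
  rewrite /= ln //; congr (_ :: _); apply/eqP.
  rewrite -(negbK (_ == _)) -has_filter; apply/hasPn=> b br.
  by rewrite -leqNgt ltnW //; exact: (allrelP desc).
move=> ndesc; have [a [b [al br]]] :
  exists a b : nat, [/\ a \in l, b \in r & ~~ (b < a)] := allrelPn ndesc.
have ne_lr (c d : nat) : c \in l -> d \in r -> c != d.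
  move=> cl dr; apply: contraTneq lr_uniq => ecd.
  by rewrite cat_uniq; apply/and3P=> -[_ /hasPn/(_ d dr)]; rewrite /= -ecd cl.
have leab := ne_lr a b al br.
rewrite -leqNgt leq_eqVlt (negPf leab) /= => ltab; right.
have := n132_cat_ge ln rn.
have sum_ge1 : 1 <= \sum_(a <- l) count (fun b => a < b) r.
  rewrite (perm_big _ (perm_to_rem al)) big_cons.
  by rewrite (leq_trans _ (leq_addr _ _)) // -has_count; apply/hasP; exists b.
move=> sum_le; do 3![split; first by lia].
have sum1 : \sum_(a <- l) count (fun b => a < b) r = 1 by lia.
have [l1 [l2 defl]] : exists l1 l2 : seq nat, l = l1 ++ a :: l2 := splitr_mem al.
have [r1 [r2 defr]] : exists r1 r2 : seq nat, r = r1 ++ b :: r2 := splitr_mem br.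
rewrite {}defl {}defr {al br sum_le sum_ge1} in lr_uniq ln rn ne_lr le1 sum1 *.
move: sum1; rewrite big_cat big_cons /= => sum1.
have cnt1 : count (fun b => a < b) (r1 ++ b :: r2) >= 1.
  by rewrite -has_count has_cat /= ltab orbT.
have gt_l12 (c d : nat) : c \in l1 ++ l2 -> d \in r1 ++ b :: r2 -> d < c.
  move=> cl dr; rewrite ltnNge; apply/negP=> lecd.
  have ltcd : c < d.
    rewrite ltn_neqAle lecd andbT ne_lr //.
    by move: cl; rewrite !mem_cat inE; case/orP=> ->; rewrite ?orbT.
  have : 1 <= \sum_(a <- l1 ++ l2) count (fun b => a < b) (r1 ++ b :: r2).
    rewrite (perm_big _ (perm_to_rem cl)) big_cons.
    by rewrite (leq_trans _ (leq_addr _ _)) // -has_count; apply/hasP; exists d.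
  by rewrite big_cat /=; lia.
have := sum1; rewrite [X in _ + (X + _)]count_cat /= ltab => cnt.
have lt_r12 (c : nat) : c \in r1 ++ r2 -> c < a.
  move=> cr; rewrite ltnNge; apply/negP=> leac.
  have ltac : a < c.
    rewrite ltn_neqAle leac ne_lr ?mem_cat ?mem_head ?orbT //.
    by move: cr; rewrite !mem_cat inE; case/orP=> ->; rewrite ?orbT.
  have : 1 <= count (fun b => a < b) (r1 ++ r2).
    by rewrite -has_count; apply/hasP; exists c.
  by rewrite count_cat; lia.
(* An entry [c] after [a] in [l] would exceed [b], so [a c b] would be a second occurrence besides
   [a n b]. *)
have l2nil : l2 = [::].
  case: l2 => // c l2 in le1 ln gt_l12 lr_uniq {sum1 cnt ne_lr} *.
  have := leq_trans (n132_catr l1 ((a :: c :: l2) ++ n :: r1 ++ b :: r2)) _.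
  rewrite catA => /(_ _ le1) /=.
  have ac : a < c by rewrite (ltn_trans ltab) // gt_l12 ?mem_cat ?mem_head ?orbT.
  have an : a < n by rewrite ln // mem_cat mem_head orbT.
have bn : b < n by rewrite rn // mem_cat mem_head orbT.
  have bc : b < c by rewrite gt_l12 ?mem_cat ?mem_head ?orbT.
  rewrite ac filter_cat /= an filter_cat /= ltab !count_cat /= !count_cat /= bc.
  rewrite inversions_cat /= !count_cat /= bn.
  lia.
exists l1, a, r1, b, r2; split=> //.
  by rewrite l2nil cats1.
apply/allrelP=> c d cl; rewrite inE => /predU1P[->|dr]; last first.
  by rewrite gt_l12 // mem_cat cl.
by rewrite (ltn_trans ltab) // gt_l12 ?mem_cat ?cl ?mem_head ?orbT.
Qed.

(** * Permutations with at most one occurrence of 132 *)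

Definition perms132 (c n : nat) : seq (seq nat) :=
  [seq s <- permutations (iota 0 n) | n132 s == c].

Lemma mem_perms132 (c n : nat) (s : seq nat) :
  (s \in perms132 c n) = (n132 s == c) && perm_eq s (iota 0 n).
Proof. by rewrite mem_filter mem_permutations. Qed.

Lemma uniq_perms132 (c n : nat) : uniq (perms132 c n).
Proof. by rewrite filter_uniq // permutations_uniq. Qed.

Lemma size_perms132 (c n : nat) (s : seq nat) : s \in perms132 c n -> size s = n.
Proof. by rewrite mem_perms132 => /andP[_ /perm_size->]; rewrite size_iota. Qed.

(** Sorted [v] followed by sorted [u] is sorted, hence equal to [iota 0 n]; cutting that list at
    [size v] identifies both parts. *)
Lemma perm_iota_split (u v : seq nat) (n : nat) :
  perm_eq (u ++ v) (iota 0 n) -> allrel (fun a b => b < a) u v ->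
  perm_eq u (iota (size v) (size u)) /\ perm_eq v (iota 0 (size v)).
Proof.
move=> puv desc.
have defn : n = size v + size u.
  by rewrite -(size_iota 0 n) -(perm_size puv) size_cat addnC.
have : sort leq v ++ sort leq u = iota 0 n.
  apply: (sorted_eq leq_trans anti_leq).
  - rewrite (sorted_pairwise leq_trans) pairwise_cat -!(sorted_pairwise leq_trans).
    rewrite !sort_sorted ?andbT; try exact: leq_total.
    apply/allrelP=> b a; rewrite !mem_sort => bv au.
    by rewrite ltnW //; exact: (allrelP desc).
  - exact: iota_sorted.
  - by rewrite (permPl (perm_cat (permEl (perm_sort _ _)) (permEl (perm_sort _ _)))) perm_catC.
rewrite defn iotaD => /eqP; rewrite eqseq_cat ?size_sort ?size_iota // => /andP[/eqP ev /eqP eu].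
by split; rewrite -perm_sym -?eu -?[iota 0 (size v)]ev perm_sort perm_refl.
Qed.

Lemma perm_iotaS_cat (l r : seq nat) (n : nat) :
  perm_eq (l ++ n :: r) (iota 0 n.+1) = perm_eq (l ++ r) (iota 0 n).
Proof.
rewrite -addn1 iotaD /= add0n; apply/idP/idP => /seq.permP eq_count; apply/seq.permP => P.
  by have := eq_count P; rewrite !count_cat /=; lia.
by have := eq_count P; rewrite !count_cat /=; lia.
Qed.

Lemma perm_iota_shift (c n : nat) (u : seq nat) :
  perm_eq u (iota c n) -> exists2 a, u = map (addn c) a & perm_eq a (iota 0 n).
Proof.
move=> pu; exists (map (subn^~ c) u).
  rewrite -map_comp -[LHS]map_id; apply/eq_in_map=> x; rewrite (perm_mem pu).
  by rewrite mem_iota /= => /andP[/subnKC->].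
have := perm_map (subn^~ c) pu.
have -> : iota c n = map (addn c) (iota 0 n) by rewrite -iotaDl addn0.
rewrite -map_comp.
by rewrite (@eq_map _ _ (_ \o _) id) ?map_id // => x /=; rewrite addKn.
Qed.

Lemma cat_cons_inj (n : nat) (l r l' r' : seq nat) :
  n \notin l -> n \notin l' -> l ++ n :: r = l' ++ n :: r' -> l = l' /\ r = r'.
Proof.
elim: l l' => [|a l IHl] [|a' l'] //=; rewrite ?inE ?negb_or.
- by move=> _ _ [].
- by move=> _ /andP[/eqP ne _] [/ne].
- by move=> /andP[/eqP ne _] _ [/esym/ne].
by move=> /andP[_ nl] /andP[_ nl'] [-> /(IHl _ nl nl')[-> ->]].
Qed.

Definition glue (a b : seq nat) : seq nat :=
  map (addn (size b)) a ++ (size a + size b) :: b.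

(* Here the maximum plays the role of 3 in the occurrence of 132: the entry
   before it is one less than the maximum of the suffix. *)
Definition glue_max (a b : seq nat) : seq nat :=
  map (addn (size b).+1) a ++
  [:: (size b).-1, (size a + size b).+1 & map (bump (size b).-1) b].

Lemma size_glue (a b : seq nat) : size (glue a b) = (size a + size b).+1.
Proof. by rewrite size_cat /= size_map addnS. Qed.

Lemma size_glue_max (a b : seq nat) : size (glue_max a b) = (size a + size b).+2.
Proof. by rewrite size_cat /= !size_map !addnS. Qed.

Lemma perm_iota_lt (n : nat) (s : seq nat) :
  perm_eq s (iota 0 n) -> {in s, forall x, x < n}.
Proof. by move=> /perm_mem ps x; rewrite ps mem_iota. Qed.

Lemma perm_glue (i j : nat) (a b : seq nat) :
  perm_eq a (iota 0 i) -> perm_eq b (iota 0 j) -> perm_eq (glue a b) (iota 0 (i + j).+1).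
Proof.
move=> pa pb; rewrite /glue (perm_size pa) (perm_size pb) !size_iota perm_iotaS_cat.
rewrite perm_catC (addnC i) iotaD perm_cat // add0n.
have -> : iota j i = map (addn j) (iota 0 i) by rewrite -iotaDl addn0.
exact: perm_map.
Qed.

Lemma perm_glue_max (i j : nat) (a b : seq nat) : 0 < j ->
  perm_eq a (iota 0 i) -> perm_eq b (iota 0 j) ->
  perm_eq (glue_max a b) (iota 0 (i + j).+2).
Proof.
move=> j_gt0 pa pb; rewrite /glue_max (perm_size pa) (perm_size pb) !size_iota.
rewrite -cat_rcons perm_iotaS_cat (_ : (i + j).+1 = j.+1 + i) ?iotaD ?add0n; last by lia.
have -> : iota 0 j.+1 = iota 0 j.-1 ++ [:: j.-1; j].
  by rewrite -[in LHS](prednK j_gt0) -addn2 iotaD /= add0n prednK.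
(* On [iota 0 j], [bump j.-1] moves only the last value, from [j.-1] to [j]; this frees [j.-1] for
   the entry before the maximum. *)
have := perm_map (bump j.-1) pb; rewrite -[in iota 0 j](prednK j_gt0) -addn1 iotaD.
rewrite map_cat /= add0n [in X in _ ++ X]/bump leqnn add1n prednK //.
have -> : map (bump j.-1) (iota 0 j.-1) = iota 0 j.-1.
  by rewrite -[RHS]map_id; apply/eq_in_map=> x; rewrite mem_iota /bump /=; lia.
have -> : iota j.+1 i = map (addn j.+1) (iota 0 i) by rewrite -iotaDl addn0.
move: (perm_map (addn j.+1) pa) => /seq.permP a_count /seq.permP b_count.
apply/seq.permP => P; have := a_count P; have := b_count P.
by rewrite -?cats1 !count_cat /=; lia.
Qed.

Lemma filter_gt_max (n : nat) (s : seq nat) :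
  {in s, forall x, x < n} -> [seq x <- s | n < x] = [::].
Proof.
move=> sn; apply/eqP; rewrite -(negbK (_ == _)) -has_filter; apply/hasPn=> x /sn.
by rewrite -leqNgt => /ltnW.
Qed.

Lemma n132_glue (i j : nat) (a b : seq nat) :
  perm_eq a (iota 0 i) -> perm_eq b (iota 0 j) ->
  n132 (glue a b) = n132 a + n132 b.
Proof.
move=> pa pb; have a_lt := perm_iota_lt pa; have b_lt := perm_iota_lt pb.
have b_lt_ij : {in b, forall x, x < i + j} by move=> x /b_lt; lia.
rewrite /glue (perm_size pa) (perm_size pb) !size_iota (@n132_cat (i + j)) /=; last first.
  move=> _ /mapP[x xa ->]; have := a_lt x xa => xi; split; first by lia.
  rewrite /= ifT; last by lia.
  by rewrite filter_gt_max // => y /b_lt; lia.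
by rewrite filter_gt_max // n132_map // => x y; rewrite ltn_add2l.
Qed.

(** After the bump, [j] is the only entry of the suffix above the inserted [j.-1], so the inserted
    entry is the 1 of exactly one occurrence, with the maximum as 3 and [j] as 2. *)
Lemma n132_glue_max (i j : nat) (a b : seq nat) : 0 < j ->
  perm_eq a (iota 0 i) -> perm_eq b (iota 0 j) ->
  n132 (glue_max a b) = (n132 a + n132 b).+1.
Proof.
move=> j_gt0 pa pb; have a_lt := perm_iota_lt pa; have b_lt := perm_iota_lt pb.
set N := (i + j).+1.
have bumpb_lt : {in map (bump j.-1) b, forall x, x < j.+1}.
  by move=> _ /mapP[x /b_lt xj ->]; rewrite /bump; lia.
rewrite /glue_max (perm_size pa) (perm_size pb) !size_iota -/N (@n132_cat N) /=; last first.
  move=> _ /mapP[x xa ->]; have := a_lt x xa => xi; rewrite /N; split; first by lia.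
  rewrite /= ifF; last by lia.
  rewrite ifT; last by lia.
  by rewrite filter_gt_max // => y /bumpb_lt; lia.
rewrite ifT; last by rewrite /N; lia.
rewrite (@filter_gt_max N); last by move=> x /bumpb_lt; rewrite /N; lia.
rewrite !n132_map; first last.
- by move=> x y; rewrite ltn_add2l.
- by move=> x y; rewrite !ltnNge leq_bump2.
have b_uniq : uniq b by rewrite (perm_uniq pb) iota_uniq.
have jb : j.-1 \in b by rewrite (perm_mem pb) mem_iota; lia.
rewrite filter_map (@eq_in_filter _ _ (pred1 j.-1)); last first.
  by move=> x /b_lt xj; rewrite /bump /=; lia.
rewrite filter_pred1_uniq //= /bump leqnn add1n prednK //.
by rewrite /N; lia.
Qed.

Section Glues.
Variables (f : seq nat -> seq nat -> seq nat) (L1 L2 : nat -> seq (seq nat)).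

(** Listing the pairs by the size of the first component makes a sum over them the coefficient of a
    product of two series, as [sum_glues] shows. *)
Definition glue_pairs (n : nat) : seq (seq nat * seq nat) :=
  flatten [seq [seq (a, b) | a <- L1 i, b <- L2 (n - i)] | i <- iota 0 n.+1].

Definition glues (n : nat) : seq (seq nat) := [seq f q.1 q.2 | q <- glue_pairs n].

Hypothesis L1_size : forall i a, a \in L1 i -> size a = i.
Hypothesis L2_size : forall i a, a \in L2 i -> size a = i.

Lemma mem_glue_pairs (n : nat) (q : seq nat * seq nat) :
  (q \in glue_pairs n) =
  [&& q.1 \in L1 (size q.1), q.2 \in L2 (size q.2) & size q.1 + size q.2 == n].
Proof.
apply/flattenP/and3P => [[s /mapP[i]]|[L1a L2b /eqP sz]].
  rewrite mem_iota => /andP[_ lt_in] {s}-> /allpairsP[[a b] /= [aL1 bL2 ->]] /=.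
  by rewrite (L1_size aL1) (L2_size bL2) subnKC.
exists [seq (a, b) | a <- L1 (size q.1), b <- L2 (n - size q.1)].
  by apply/mapP; exists (size q.1) => //; rewrite mem_iota; lia.
by apply/allpairsP; exists q; rewrite -surjective_pairing -sz addKn.
Qed.

Lemma uniq_glue_pairs (n : nat) :
  (forall i, uniq (L1 i)) -> (forall i, uniq (L2 i)) -> uniq (glue_pairs n).
Proof.
move=> uL1 uL2; rewrite /glue_pairs.
elim: (iota 0 n.+1) (iota_uniq 0 n.+1) => //= i s IHs /andP[nis /IHs us].
rewrite cat_uniq us andbT allpairs_uniq ?uL1 ?uL2 //=; last by move=> [? ?] [? ?].
apply/hasPn=> q /flattenP[_ /mapP[i' i's ->] /allpairsP[[a b] /= [aL1 _ ->]]].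
apply/allpairsP => -[[a' b'] /= [a'L1 _ [eqa _]]]; move: nis.
by rewrite -(L1_size a'L1) -eqa (L1_size aL1) i's.
Qed.

Lemma uniq_glues (n : nat) :
  (forall i, uniq (L1 i)) -> (forall i, uniq (L2 i)) ->
  {in glue_pairs n &, injective (fun q => f q.1 q.2)} -> uniq (glues n).
Proof. by move=> uL1 uL2 f_inj; rewrite map_inj_in_uniq ?uniq_glue_pairs. Qed.

Lemma sum_glues (V : nmodType) (F : seq nat -> V) (n : nat) :
  (\sum_(s <- glues n) F s = \sum_(i < n.+1) \sum_(a <- L1 i) \sum_(b <- L2 (n - i)) F (f a b))%R.
Proof.
rewrite big_map big_flatten big_map -[iota 0 n.+1]/(index_iota 0 n.+1) big_mkord.
by apply: eq_bigr => i _; rewrite big_allpairs_dep.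
Qed.

End Glues.

(** The position of the maximum determines the cut, and the shift of the left part is the size of
    the right part. *)
Lemma glue_inj (q q' : seq nat * seq nat) :
  perm_eq q.1 (iota 0 (size q.1)) -> perm_eq q.2 (iota 0 (size q.2)) ->
  perm_eq q'.1 (iota 0 (size q'.1)) -> perm_eq q'.2 (iota 0 (size q'.2)) ->
  glue q.1 q.2 = glue q'.1 q'.2 -> q = q'.
Proof.
case: q q' => [a b] [a' b'] /= pa pb pa' pb' eq_glue.
have eq_size := congr1 size eq_glue; rewrite !size_glue in eq_size.
case: eq_size => eq_size; move: eq_glue; rewrite /glue eq_size.
case/cat_cons_inj.
- by apply/mapP=> -[x /(perm_iota_lt pa)]; lia.
- by apply/mapP=> -[x /(perm_iota_lt pa')]; lia.
by move=> + eq_b; rewrite eq_b => /(inj_map (@addnI _))->.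
Qed.

Lemma glue_max_inj (q q' : seq nat * seq nat) :
  perm_eq q.1 (iota 0 (size q.1)) -> perm_eq q.2 (iota 0 (size q.2)) ->
  perm_eq q'.1 (iota 0 (size q'.1)) -> perm_eq q'.2 (iota 0 (size q'.2)) ->
  glue_max q.1 q.2 = glue_max q'.1 q'.2 -> q = q'.
Proof.
case: q q' => [a b] [a' b'] /= pa pb pa' pb' eq_glue.
have eq_size := congr1 size eq_glue; rewrite !size_glue_max in eq_size.
case: eq_size => eq_size; move: eq_glue; rewrite /glue_max eq_size.
rewrite -(cat_rcons (size b).-1) -(cat_rcons (size b').-1).
case/cat_cons_inj.
- rewrite mem_rcons inE negb_or; apply/andP; split; first by lia.
  by apply/mapP=> -[x /(perm_iota_lt pa)]; lia.
- rewrite mem_rcons inE negb_or; apply/andP; split; first by lia.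
  by apply/mapP=> -[x /(perm_iota_lt pa')]; lia.
move=> /rcons_inj[eq_a _] eq_b; have := congr1 size eq_b.
rewrite !size_map => eq_szb; rewrite eq_szb in eq_a eq_b.
by rewrite (inj_map (@addnI _) eq_a) (inj_map (can_inj (@bumpK _)) eq_b).
Qed.

Lemma perm_perms132 (c n : nat) (a : seq nat) :
  a \in perms132 c n -> perm_eq a (iota 0 (size a)).
Proof. by move=> an; rewrite (size_perms132 an); move: an; rewrite mem_perms132 => /andP[]. Qed.

Lemma iota_max_split (n : nat) (s : seq nat) : perm_eq s (iota 0 n.+1) ->
  exists l r, [/\ s = l ++ n :: r, perm_eq (l ++ r) (iota 0 n),
    {in l, forall a, a < n}, {in r, forall a, a < n} & uniq (l ++ r)].
Proof.
move=> ps; have [l [r defs]] : exists l r, s = l ++ n :: r.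
  by apply: splitr_mem; rewrite (perm_mem ps) mem_iota ltnSn.
have plr : perm_eq (l ++ r) (iota 0 n) by rewrite -perm_iotaS_cat -defs.
exists l, r; split; rewrite ?(perm_uniq plr) ?iota_uniq //.
  by move=> x xl; rewrite (perm_iota_lt plr) // mem_cat xl.
by move=> x xr; rewrite (perm_iota_lt plr) // mem_cat xr orbT.
Qed.

Lemma desc_glue (n : nat) (l r : seq nat) :
  perm_eq (l ++ r) (iota 0 n) -> allrel (fun a b => b < a) l r ->
  exists2 a, l ++ n :: r = glue a r &
    [/\ perm_eq a (iota 0 (size a)), perm_eq r (iota 0 (size r)) & size a + size r = n].
Proof.
move=> plr desc; have [pl pr] := perm_iota_split plr desc.
have [a defl pa] := perm_iota_shift pl.
have size_a : size a = size l by rewrite defl size_map.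
have sz : size l + size r = n by rewrite -size_cat (perm_size plr) size_iota.
exists a; first by rewrite /glue -defl size_a sz.
by rewrite size_a.
Qed.

Lemma mem_glues (c d n : nat) (s : seq nat) :
  s \in glues glue (perms132 c) (perms132 d) n <->
  exists a b, [/\ s = glue a b, size a + size b = n, n132 a = c /\ n132 b = d,
    perm_eq a (iota 0 (size a)) & perm_eq b (iota 0 (size b))].
Proof.
split=> [/mapP[[a b]]|[a [b [-> sz [ac bd] pa pb]]]].
  rewrite mem_glue_pairs; try exact: size_perms132.
  rewrite /= !mem_perms132 => /and3P[/andP[/eqP ac pa] /andP[/eqP bd pb] /eqP sz] ->.
  by exists a, b.
apply/mapP; exists (a, b) => //; rewrite mem_glue_pairs; try exact: size_perms132.
by rewrite /= !mem_perms132 ac bd pa pb sz !eqxx.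
Qed.

Lemma uniq_glues_perms132 (c d n : nat) : uniq (glues glue (perms132 c) (perms132 d) n).
Proof.
apply: uniq_glues => [|i|i|q q']; try exact: uniq_perms132.
  exact: size_perms132.
rewrite !mem_glue_pairs; try exact: size_perms132.
by move=> /and3P[/perm_perms132 ? /perm_perms132 ? _]
  /and3P[/perm_perms132 ? /perm_perms132 ? _]; exact: glue_inj.
Qed.

Lemma perms132_0S (n : nat) :
  perm_eq (perms132 0 n.+1) (glues glue (perms132 0) (perms132 0) n).
Proof.
apply: uniq_perm; [exact: uniq_perms132 | exact: uniq_glues_perms132 |].
move=> s; apply/idP/idP => [|/mem_glues[a [b [-> <- [a0 b0] pa pb]]]]; last first.
  by rewrite mem_perms132 (n132_glue pa pb) a0 b0 perm_glue.
rewrite mem_perms132 => /andP[/eqP s0 /iota_max_split[l [r [defs plr ln rn ulr]]]].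
have [|[desc _]|[]] := n132_split ln rn ulr; rewrite -?defs ?s0 //.
have [a def_s [pa pr sz]] := desc_glue plr desc.
have /esym/eqP : n132 s = n132 a + n132 r by rewrite defs def_s (n132_glue pa pr).
rewrite s0 addn_eq0 => /andP[/eqP a0 /eqP r0].
by apply/mem_glues; exists a, r; split=> //; rewrite -def_s.
Qed.

(** The suffix of [glue_max] holds the 2 of the occurrence, so it is never empty. *)
Definition perms132_pos (n : nat) : seq (seq nat) :=
  if n is 0 then [::] else perms132 0 n.

Lemma mem_perms132_pos (n : nat) (s : seq nat) :
  (s \in perms132_pos n) = (0 < n) && (s \in perms132 0 n).
Proof. by case: n. Qed.

Lemma size_perms132_pos (n : nat) (s : seq nat) : s \in perms132_pos n -> size s = n.
Proof. by rewrite mem_perms132_pos => /andP[_ /size_perms132]. Qed.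

Lemma mem_glues_max (n : nat) (s : seq nat) :
  s \in glues glue_max (perms132 0) perms132_pos n <->
  exists a b, [/\ s = glue_max a b, size a + size b = n, n132 a = 0 /\ n132 b = 0,
    perm_eq a (iota 0 (size a)) & perm_eq b (iota 0 (size b)) /\ 0 < size b].
Proof.
split=> [/mapP[[a b]]|[a [b [-> sz [a0 b0] pa [pb b_gt0]]]]].
  rewrite mem_glue_pairs; [|exact: size_perms132|exact: size_perms132_pos].
  rewrite /= mem_perms132_pos !mem_perms132.
  by move=> /and3P[/andP[/eqP a0 pa] /and3P[b_gt0 /eqP b0 pb] /eqP sz] ->; exists a, b.
apply/mapP; exists (a, b) => //.
rewrite mem_glue_pairs; [|exact: size_perms132|exact: size_perms132_pos].
by rewrite /= mem_perms132_pos !mem_perms132 a0 b0 pa pb b_gt0 sz !eqxx.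
Qed.

Lemma uniq_glues_max (n : nat) : uniq (glues glue_max (perms132 0) perms132_pos n).
Proof.
apply: uniq_glues => [|i|i|q q'].
- exact: size_perms132.
- exact: uniq_perms132.
- by case: i => // i; exact: uniq_perms132.
rewrite !mem_glue_pairs; try exact: size_perms132; try exact: size_perms132_pos.
rewrite !mem_perms132_pos.
by move=> /and3P[/perm_perms132 ? /andP[_ /perm_perms132 ?] _]
  /and3P[/perm_perms132 ? /andP[_ /perm_perms132 ?] _]; exact: glue_max_inj.
Qed.

(** The entry just before the maximum tells the two apart: in [glue_max] it is less than the size of
    the suffix, in [glue] every entry before the maximum is at least that size. *)
Lemma glue_neq_max (a b a' b' : seq nat) :
  perm_eq a (iota 0 (size a)) -> perm_eq b (iota 0 (size b)) ->
  perm_eq a' (iota 0 (size a')) -> perm_eq b' (iota 0 (size b')) -> 0 < size b' ->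
  glue a b <> glue_max a' b'.
Proof.
move=> pa pb pa' pb' b'_gt0 eq_glue.
have eq_size := congr1 size eq_glue; rewrite size_glue size_glue_max in eq_size.
case: eq_size => eq_size; move: eq_glue; rewrite /glue_max /glue eq_size.
rewrite -(cat_rcons (size b').-1) => /cat_cons_inj[||eq_a eq_b].
- by apply/mapP=> -[x /(perm_iota_lt pa)]; lia.
- rewrite mem_rcons inE negb_or; apply/andP; split; first by lia.
  by apply/mapP=> -[x /(perm_iota_lt pa')]; lia.
have : (size b').-1 \in map (addn (size b)) a by rewrite eq_a mem_rcons mem_head.
case/mapP=> x _; have -> : size b = size b' by rewrite eq_b size_map.
lia.
Qed.

(** From the top, the values are those of [l1], then [b], then [a], then those of [r1 ++ r2]. With
    [j] entries in [r1 ++ r2] this forces [a = j] and [b = j + 1], and lowering [b] to [j] turns the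
    suffix into a permutation of [iota 0 j.+1]. *)
Lemma glue_max_of_split (n a b : nat) (l1 r1 r2 : seq nat) :
  perm_eq (rcons l1 a ++ r1 ++ b :: r2) (iota 0 n) ->
  allrel (fun x y => y < x) l1 (a :: r1 ++ b :: r2) -> a < b ->
  {in r1 ++ r2, forall x, x < a} ->
  exists a' b', [/\ rcons l1 a ++ n :: r1 ++ b :: r2 = glue_max a' b',
    size a' + size b' = n.-1, 0 < size b',
    perm_eq a' (iota 0 (size a')) & perm_eq b' (iota 0 (size b'))].
Proof.
rewrite cat_rcons => plr desc ab r_lt; have sz := perm_size plr.
rewrite !(size_cat, size_iota) /= size_cat /= in sz.
set j := (size r1 + size r2).
have [] := perm_iota_split plr desc.
have -> : size (a :: r1 ++ b :: r2) = j.+2 by rewrite /= size_cat /= addnS.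
move=> pl1 par; have [a' defl pa'] := perm_iota_shift pl1.
rewrite defl size_map in sz; have p1 : perm_eq ([:: b] ++ a :: (r1 ++ r2)) (iota 0 j.+2).
  rewrite -(permPr par); apply/seq.permP=> P.
  by rewrite /= !count_cat /=; lia.
have [] := perm_iota_split p1.
  rewrite /allrel /= andbT ab /=; apply/allP=> x /r_lt; lia.
rewrite /= size_cat -/j => /perm_mem/(_ b); rewrite !inE eqxx => /esym/eqP eb p2.
have [] := @perm_iota_split [:: a] (r1 ++ r2) j.+1 p2.
  by rewrite /allrel /= andbT; apply/allP=> x /r_lt.
rewrite /= size_cat -/j => /perm_mem/(_ a); rewrite !inE eqxx => /esym/eqP ea p3.
have p4 : perm_eq (r1 ++ j :: r2) (iota 0 j.+1) by rewrite perm_iotaS_cat.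
exists a', (r1 ++ j :: r2).
have -> : size (r1 ++ j :: r2) = j.+1 by rewrite size_cat /= addnS.
have size_a' : size a' = size l1 by rewrite defl size_map.
split=> //; [|lia|by rewrite size_a'].
rewrite /glue_max size_cat /= addnS -/j /= cat_rcons defl eb ea.
rewrite map_cat /= {2}/bump leqnn add1n.
have -> : map (bump j) r1 = r1.
  rewrite -[RHS]map_id; apply/eq_in_map=> x xr; have := r_lt x.
  by rewrite mem_cat xr ea => /(_ isT) xj; rewrite /bump leqNgt xj.
have -> : map (bump j) r2 = r2.
  rewrite -[RHS]map_id; apply/eq_in_map=> x xr; have := r_lt x.
  by rewrite mem_cat xr orbT ea => /(_ isT) xj; rewrite /bump leqNgt xj.
by congr (_ ++ [:: _, _ & _]); lia.
Qed.

(** The occurrence lies left of the maximum, right of it, or uses it. In the last case the size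
    drops by two, because [glue_max] inserts two entries. *)
Lemma perms132_1S (n : nat) :
  perm_eq (perms132 1 n.+1)
    (glues glue (perms132 1) (perms132 0) n ++ glues glue (perms132 0) (perms132 1) n ++
     if n is n'.+1 then glues glue_max (perms132 0) perms132_pos n' else [::]).
Proof.
apply: uniq_perm.
- exact: uniq_perms132.
- rewrite !cat_uniq !uniq_glues_perms132 /=; apply/and3P; split.
  + apply/hasPn=> s; rewrite mem_cat => /orP[|].
      case/mem_glues=> a [b [-> _ [a0 _] pa pb]]; apply/negP.
      move=> /mem_glues[a' [b' [eq_glue _ [a1 _] pa' pb']]].
      by move: a1; case: (@glue_inj (a, b) (a', b') pa pb pa' pb' eq_glue) => <-; rewrite a0.
    case: n => // n /mem_glues_max[a [b [-> _ _ pa [pb b_gt0]]]]; apply/negP.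
    move=> /mem_glues[a' [b' [/esym eq_glue _ _ pa' pb']]].
    by case: (glue_neq_max pa' pb' pa pb b_gt0 eq_glue).
  + case: n => // n; apply/hasPn=> s /mem_glues_max[a [b [-> _ _ pa [pb b_gt0]]]].
    apply/negP=> /mem_glues[a' [b' [/esym eq_glue _ _ pa' pb']]].
    by case: (glue_neq_max pa' pb' pa pb b_gt0 eq_glue).
  + by case: n => // n; exact: uniq_glues_max.
move=> s; rewrite !mem_cat mem_perms132; apply/andP/or3P => [[/eqP s1]|].
  case/iota_max_split=> l [r [defs plr ln rn ulr]].
  have [|[desc n132s]|[_ [l0 [r0]]]] := n132_split ln rn ulr; rewrite -?defs ?s1 //.
    have [a def_s [pa pr sz]] := desc_glue plr desc.
    have : n132 s = n132 a + n132 r by rewrite defs def_s (n132_glue pa pr).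
    rewrite s1; case: (n132 a =P 0) => [a0|a_neq0] sum1.
      by constructor 2; apply/mem_glues; exists a, r; split=> //; [rewrite -def_s | split; lia].
    by constructor 1; apply/mem_glues; exists a, r; split=> //; [rewrite -def_s | split; lia].
  case=> l1 [a [r1 [b [r2 [defl defr desc ab r_lt]]]]].
  rewrite defl defr in plr defs desc.
  have [a' [b' [def_s sz b_gt0 pa pb]]] := glue_max_of_split plr desc ab r_lt.
  constructor 3; have : n132 s = (n132 a' + n132 b').+1.
    by rewrite defs def_s (n132_glue_max b_gt0 pa pb).
  rewrite s1; have := perm_size plr; rewrite size_iota size_cat size_rcons.
  case: n sz {plr desc ln rn} def_s defs => //= n sz def_s defs _ sum0; apply/mem_glues_max.
  by exists a', b'; split=> //; [rewrite -def_s | split; lia].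
case.
- case/mem_glues=> a [b [-> sz [a1 b0] pa pb]].
  by rewrite (n132_glue pa pb) a1 b0 -sz perm_glue.
- case/mem_glues=> a [b [-> sz [a0 b1] pa pb]].
  by rewrite (n132_glue pa pb) a0 b1 -sz perm_glue.
case: n => // n /mem_glues_max[a [b [-> sz [a0 b0] pa [pb b_gt0]]]].
by rewrite (n132_glue_max b_gt0 pa pb) a0 b0 -sz perm_glue_max.
Qed.

(** * Occurrences of [k,m] *)

(* The pattern [p + m, m] splits into its first p entries u and its last m
   entries v; for m = 0 it is the increasing pattern of length p. *)
Definition skew (p m : nat) (u v : seq nat) : Prop :=
  [/\ size u = p, size v = m, pairwise ltn u, pairwise ltn v & allrel (fun a b => b < a) u v].

(** Quantifying over bit masks makes containment a boolean, which can be turned into a 0-1 weight;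
    [occP] gives back the form with subsequences. *)
Definition occ (p m : nat) (s : seq nat) : bool :=
  [exists b : (size s).-tuple bool, let w := mask b s in
    [&& size w == p + m, pairwise ltn (take p w), pairwise ltn (drop p w) &
      allrel (fun a b => b < a) (take p w) (drop p w)]].

Local Notation inc p := (occ p 0).

Lemma occP (p m : nat) (s : seq nat) :
  reflect (exists u v : seq nat, subseq (u ++ v) s /\ skew p m u v) (occ p m s).
Proof.
apply: (iffP existsP) => [[b /and4P[/eqP sz tk dr all_gt]]|[u [v [/subseqP[b szb uv]]]]].
  exists (take p (mask b s)), (drop p (mask b s)); rewrite cat_take_drop mask_subseq.
  by split=> //; split; rewrite ?size_take ?size_drop ?sz //; try case: ifP; lia.
case=> szu szv uS vS all_gt; have szb' : size b == size s by rewrite szb.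
exists (Tuple szb') => /=; rewrite -uv -szu -szv size_cat eqxx take_size_cat // drop_size_cat //.
by rewrite uS vS all_gt.
Qed.

Lemma incP (p : nat) (s : seq nat) :
  reflect (exists u : seq nat, [/\ subseq u s, size u = p & pairwise ltn u]) (inc p s).
Proof.
apply: (iffP (occP _ _ _)) => [[u [v [uv [su sv uS _ _]]]]|[u [us szu uS]]].
  by exists u; move: uv; rewrite (size0nil sv) cats0.
by exists u, [::]; rewrite cats0; split=> //; split=> //; rewrite allrel0r.
Qed.

Lemma occ_subseq (p m : nat) (s1 s2 : seq nat) : subseq s1 s2 -> occ p m s1 -> occ p m s2.
Proof.
by move=> s12 /occP[u [v [uv ?]]]; apply/occP; exists u, v; split=> //; apply: subseq_trans s12.
Qed.

Lemma inc_leq (p q : nat) (s : seq nat) : p <= q -> inc q s -> inc p s.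
Proof.
move=> lepq /incP[u [us szu uS]]; apply/incP; exists (take p u); split.
- exact: subseq_trans (take_subseq _ _) us.
- by rewrite size_take szu; case: ltnP; lia.
- exact: subseq_pairwise (take_subseq _ _) uS.
Qed.

Lemma occ_incl (p m : nat) (s : seq nat) : occ p m s -> inc p s.
Proof.
case/occP=> u [v [uv [su _ uS _ _]]]; apply/incP; exists u; split=> //.
exact: subseq_trans (prefix_subseq _ _) uv.
Qed.

Lemma occ_incr (p m : nat) (s : seq nat) : occ p m s -> inc m s.
Proof.
case/occP=> u [v [uv [_ sv _ vS _]]]; apply/incP; exists v; split=> //.
exact: subseq_trans (suffix_subseq _ _) uv.
Qed.

Lemma occ_size (p m : nat) (s : seq nat) : occ p m s -> p + m <= size s.
Proof. by case/occP=> u [v [/size_subseq + [<- <- _ _ _]]]; rewrite size_cat. Qed.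

Lemma inc0 (s : seq nat) : inc 0 s.
Proof. by apply/incP; exists [::]; rewrite sub0seq. Qed.

Lemma inc1 (s : seq nat) : inc 1 s = (s != [::]).
Proof.
apply/incP/idP => [[u [us szu _]]|]; first by case: s us => //; case: u szu.
by case: s => // x s _; exists [:: x]; rewrite sub1seq mem_head.
Qed.

Lemma occ_map (f : nat -> nat) (p m : nat) (s : seq nat) :
  {mono f : a b / a < b} -> occ p m (map f s) = occ p m s.
Proof.
move=> fmono; apply/occP/occP => [[u [v [/subseqP[b _]]]]|[u [v [uv [szu szv uS vS all_gt]]]]].
  rewrite -map_mask => uv [szu szv uS vS all_gt].
  have sizep : p <= size (mask b s) by rewrite -(size_map f) -uv size_cat szu leq_addr.
  have defu : u = map f (take p (mask b s)) by rewrite map_take -uv -szu take_size_cat.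
  have defv : v = map f (drop p (mask b s)) by rewrite map_drop -uv -szu drop_size_cat.
  exists (take p (mask b s)), (drop p (mask b s)); rewrite cat_take_drop mask_subseq.
  move: uS vS all_gt; rewrite defu defv !pairwise_map allrel_mapl allrel_mapr.
  move=> uS vS all_gt; split=> //; split.
  - by rewrite -(size_map f) -defu.
  - by rewrite -(size_map f) -defv.
  - by apply: sub_pairwise uS => x y /=; rewrite fmono.
  - by apply: sub_pairwise vS => x y /=; rewrite fmono.
  - by apply: sub_allrel all_gt => x y /=; rewrite fmono.
exists (map f u), (map f v); rewrite -map_cat map_subseq //; split=> //.
split; rewrite ?size_map // ?pairwise_map ?allrel_mapl ?allrel_mapr.
- by apply: sub_pairwise uS => x y /=; rewrite fmono.
- by apply: sub_pairwise vS => x y /=; rewrite fmono.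
- by apply: sub_allrel all_gt => x y /=; rewrite fmono.
Qed.

Lemma subseq_catP (w l r : seq nat) :
  subseq w (l ++ r) -> exists w1 w2 : seq nat, [/\ w = w1 ++ w2, subseq w1 l & subseq w2 r].
Proof.
case/subseqP=> b szb ->; exists (mask (take (size l) b) l), (mask (drop (size l) b) r).
by rewrite !mask_subseq -mask_cat ?cat_take_drop // size_takel // szb size_cat leq_addr.
Qed.

Lemma cat_eq_cat (u v w1 w2 : seq nat) : u ++ v = w1 ++ w2 ->
  (exists z : seq nat, u = w1 ++ z /\ w2 = z ++ v) \/
  (exists z : seq nat, w1 = u ++ z /\ v = z ++ w2).
Proof.
elim: u w1 => [|a u IHu] [|b w1] /=.
- by move->; left; exists [::].
- by move->; right; exists (b :: w1).
- by move<-; left; exists (a :: u).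
case=> <- /IHu[[z [-> ->]]|[z [-> ->]]]; first by left; exists z.
by right; exists z.
Qed.

(** No increasing sequence has entries on both sides, so neither block of the pattern is cut: an
    occurrence lies on one side or is divided exactly between its blocks. *)
Lemma occ_desc (p m : nat) (l r : seq nat) : allrel (fun a b => b < a) l r ->
  occ p m (l ++ r) = [|| occ p m l, occ p m r | inc p l && inc m r].
Proof.
move=> /allrelP desc; apply/idP/or3P => [|[] H]; last first.
- case/andP: H => /incP[u [ul szu uS]] /incP[v [vr szv vS]].
  apply/occP; exists u, v; rewrite cat_subseq //; split=> //; split=> //.
  by apply/allrelP=> x y /(mem_subseq ul) xl /(mem_subseq vr); exact: desc.
- exact: occ_subseq (suffix_subseq _ _) H.
- exact: occ_subseq (prefix_subseq _ _) H.
have asym w1 w2 : subseq w1 l -> subseq w2 r -> pairwise ltn (w1 ++ w2) -> w1 = [::] \/ w2 = [::].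
  case: w1 => [|x w1]; [by left|]; case: w2 => [|y w2]; [by right|].
  move=> /mem_subseq/(_ x (mem_head _ _)) xl /mem_subseq/(_ y (mem_head _ _)) yr.
  rewrite pairwise_cat => /and3P[/allrelP/(_ x y (mem_head _ _) (mem_head _ _)) xy _ _].
  by have := desc _ _ xl yr; rewrite ltnNge ltnW.
case/occP=> u [v [/subseq_catP[w1 [w2 [uvw w1l w2r]]] [szu szv uS vS all_gt]]].
case: (cat_eq_cat uvw) => -[z [def1 def2]].
  have zr : subseq z r by rewrite (subseq_trans _ w2r) // def2 prefix_subseq.
  case: (asym w1 z) => //; first by rewrite -def1.
    by move=> w10; constructor 2; apply/occP; exists u, v; split=> //; rewrite uvw w10.
  move=> z0; constructor 3; rewrite z0 /= cats0 in def1 def2; apply/andP.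
  by split; apply/incP; [exists u; rewrite {1}def1 | exists v; rewrite -{1}def2].
have zl : subseq z l by rewrite (subseq_trans _ w1l) // def1 suffix_subseq.
case: (asym z w2) => //; first by rewrite -def2.
  move=> z0; constructor 3; rewrite z0 /= cats0 in def1 def2; apply/andP.
  by split; apply/incP; [exists u; rewrite -{1}def1 | exists v; rewrite {1}def2].
move=> w20; constructor 1; apply/occP; exists u, v.
by split=> //; rewrite uvw w20 cats0.
Qed.

Lemma inc_rcons_max (n p : nat) (l : seq nat) :
  {in l, forall x, x < n} -> inc p.+1 (rcons l n) = inc p l.
Proof.
move=> ln; apply/incP/incP => [[u [ul szu uS]]|[u [ul szu uS]]]; last first.
  exists (rcons u n); rewrite -!cats1 cat_subseq //; split=> //.
    by rewrite size_cat szu addn1.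
  rewrite pairwise_cat uS /= andbT; apply/allrelP=> x y /(mem_subseq ul) /ln.
  by rewrite inE => ? /eqP->.
exists (take p u); move: ul; rewrite -cats1 => /subseq_catP[w1 [w2 [defu w1l w2n]]].
split; last exact: subseq_pairwise (take_subseq _ _) uS.
  have sz2 : size w2 <= 1 := size_subseq w2n.
  have szw1 : p <= size w1 by move: szu; rewrite defu size_cat; lia.
  by rewrite defu takel_cat // (subseq_trans (take_subseq _ _)).
by rewrite size_takel // szu.
Qed.

(** A final maximum could only be the last entry of the lower block, which lies below the nonempty
    upper block. *)
Lemma occ_rcons_max (n p m : nat) (l : seq nat) :
  {in l, forall x, x < n} -> occ p.+1 m.+1 (rcons l n) = occ p.+1 m.+1 l.
Proof.
move=> ln; apply/idP/idP; last by rewrite -cats1; apply: occ_subseq (prefix_subseq _ _).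
case/occP=> u [v [uvl [szu szv uS vS all_gt]]]; apply/occP; exists u, v; split=> //.
move: uvl; rewrite -cats1 => /subseq_catP[w1 [w2 [defuv w1l]]].
rewrite defuv; case: w2 defuv => [|x [|? w2]] defuv; rewrite ?cats0 //; last by move/size_subseq.
rewrite sub1seq inE => /eqP ex; move: defuv; rewrite {}ex.
case/lastP: v szv all_gt {vS} => // v y _ all_gt; rewrite -rcons_cat cats1 => /rcons_inj[def_w1 ey].
case: u szu all_gt def_w1 {uS} => // z u _ /allrelP/(_ z y (mem_head _ _)).
rewrite mem_rcons mem_head ey => /(_ isT) nx def_w1.
by have := ln z; rewrite (mem_subseq w1l) -?def_w1 ?mem_head // => /(_ isT); lia.
Qed.

(** The maximum is counted with the left part, where it lengthens every increasing sequence by one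
    but joins no occurrence with two nonempty blocks; hence [inc p a] for an upper block of length
    [p.+1]. *)
Lemma occ_glue (i j p m : nat) (a b : seq nat) :
  perm_eq a (iota 0 i) -> perm_eq b (iota 0 j) ->
  occ p.+1 m.+1 (glue a b) = [|| occ p.+1 m.+1 a, occ p.+1 m.+1 b | inc p a && inc m.+1 b].
Proof.
move=> pa pb; rewrite /glue (perm_size pa) (perm_size pb) !size_iota -cat_rcons.
have a_lt : {in map (addn j) a, forall x, x < i + j}.
  by move=> _ /mapP[x /(perm_iota_lt pa) + ->]; lia.
rewrite occ_desc; last first.
  apply/allrelP=> x y; rewrite mem_rcons inE => + /(perm_iota_lt pb) yj.
  by case/predU1P=> [->|/mapP[z _ ->]]; lia.
rewrite occ_rcons_max // inc_rcons_max // !occ_map // => x y; exact: ltn_add2l.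
Qed.

Lemma inc_glue (i j p : nat) (a b : seq nat) :
  perm_eq a (iota 0 i) -> perm_eq b (iota 0 j) ->
  inc p.+1 (glue a b) = inc p a || inc p.+1 b.
Proof.
move=> pa pb; rewrite /glue (perm_size pa) (perm_size pb) !size_iota -cat_rcons.
have a_lt : {in map (addn j) a, forall x, x < i + j}.
  by move=> _ /mapP[x /(perm_iota_lt pa) + ->]; lia.
rewrite occ_desc; last first.
  apply/allrelP=> x y; rewrite mem_rcons inE => + /(perm_iota_lt pb) yj.
  by case/predU1P=> [->|/mapP[z _ ->]]; lia.
rewrite !inc_rcons_max // inc0 andbT !occ_map; last by move=> x y; exact: ltn_add2l.
by case: (inc p a); case: (inc p.+1 b).
Qed.

Lemma pairwise_ltn_const (c : nat) (s : seq nat) :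
  pairwise ltn s -> {in s, forall x, x = c} -> s != [::] -> s = [:: c].
Proof.
case: s => [|x [|y s]] //= sS sc _; first by rewrite (sc x) // mem_head.
have xc : x = c by apply: sc; rewrite mem_head.
have yc : y = c by apply: sc; rewrite !inE eqxx orbT.
by move: sS; rewrite xc yc ltnn.
Qed.

(** * Occurrences of [[k,m]] when the maximum is the 3 of the occurrence of 132 *)

Section GlueMaxWord.
Variables (x b n : nat) (l r1 r2 : seq nat).
Hypotheses (l_gt : {in l, forall y, x < y /\ b < y}) (l_lt : {in l, forall y, y < n}).
Hypotheses (r_lt : {in r1 ++ r2, forall y, y < x}) (xb : x < b) (bn : b < n).
Let r := r1 ++ b :: r2.
Let w := l ++ [:: x, n & r].

Let r_cases : {in r, forall y, y = b \/ y < x}.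
Proof.
move=> y; rewrite mem_cat inE orbCA => /predU1P[->|yr]; [by left|right].
by rewrite r_lt // mem_cat.
Qed.

Let l_r : {in l & r, forall y z, z < y}.
Proof. by move=> y z /l_gt[xy by_] /r_cases[->|] //; lia. Qed.

Lemma subseq_xn (u : seq nat) : subseq u [:: x; n] ->
  [\/ u = [::], u = [:: x], u = [:: n] | u = [:: x; n]].
Proof.
case/subseqP=> -[|b1 [|b2 []]] //= _ ->.
by case: b1 b2 => [] []; [constructor 4|constructor 2|constructor 3|constructor 1].
Qed.

Lemma pairwise_ltn_gt_last (u : seq nat) (y : nat) :
  pairwise ltn (u ++ [:: y]) -> {in u, forall z, y < z} -> u = [::].
Proof.
case: u => // z u; rewrite pairwise_cat.
move=> /andP[/allrelP/(_ z y (mem_head _ _) (mem_head _ _)) zy _].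
by move=> /(_ z (mem_head _ _)); lia.
Qed.

(** All of [l], and [n], lie above [r], and [b] is the only entry of [r] above [x]; so [x b] is the
    only ascent into [r]. *)
Lemma asc_cross (u v : seq nat) :
  {subset u <= l ++ [:: x; n]} -> {subset v <= r} -> pairwise ltn (u ++ v) ->
  u != [::] -> v != [::] -> u = [:: x] /\ v = [:: b].
Proof.
move=> ul vr; rewrite pairwise_cat => /and3P[/allrelP uv uS vS] u_neq0 v_neq0.
have ux : {in u, forall y, y = x}.
  case: v v_neq0 uv vr {vS} => // z v _ uv vr y yu.
  have := uv y z yu (mem_head _ _); have zr := vr z (mem_head _ _).
  have := ul y yu; rewrite mem_cat !inE => /or3P[yl|/eqP->|/eqP->] //.
    by have := l_r yl zr; lia.
  by case: (r_cases zr); lia.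
split; first exact: pairwise_ltn_const.
apply: pairwise_ltn_const => // z zv; case: (r_cases (vr z zv)) => // zx.
case: u u_neq0 uv ux {ul uS} => // y u _ uv ux.
by have := uv y z (mem_head _ _) zv; rewrite (ux y (mem_head _ _)); lia.
Qed.

(** Length three excludes [x n] and [x b], which cannot be extended; what remains lies in [r], or in
    [l] with [n] possibly added at the end. *)
Lemma inc_glue_max_word (p : nat) : inc p.+3 w = inc p.+2 l || inc p.+3 r.
Proof.
apply/idP/orP=> [|[/incP[u [ul szu uS]]|]]; last 2 first.
- apply/incP; exists (rcons u n); split.
  + by rewrite -cats1 /w cat_subseq // sub1seq !inE eqxx orbT.
  + by rewrite size_rcons szu.
  + rewrite -cats1 pairwise_cat uS /= andbT; apply/allrelP=> y z /(mem_subseq ul) /l_lt.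
    by rewrite inE => ? /eqP->.
- apply: occ_subseq; rewrite /w -[[:: x, n & r]]/([:: x; n] ++ r) catA; exact: suffix_subseq.
case/incP=> u [uw szu uS]; move: uw; rewrite /w.
move=> /subseq_catP[w3 [w' [defu w3l]]]; rewrite -[[:: x, n & r]]/([:: x; n] ++ r).
move=> /subseq_catP[w4 [w2 [defw' w4xn w2r]]]; rewrite {}defw' in defu.
have w1l : {subset w3 ++ w4 <= l ++ [:: x; n]} by apply: mem_subseq; rewrite cat_subseq.
have w3x : {in w3, forall z, x < z} by move=> z /(mem_subseq w3l) /l_gt[].
have [w10|w1_neq0] := eqVneq (w3 ++ w4) [::].
  by right; apply/incP; exists u; rewrite {1}defu catA w10.
have [w20|w2_neq0] := eqVneq w2 [::]; last first.
  rewrite catA in defu; case: (asc_cross w1l (mem_subseq w2r) _ w1_neq0 w2_neq0).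
    by rewrite -defu.
  by move=> w1E w2E; move: szu; rewrite defu w1E w2E.
left; apply/incP; exists (take p.+2 u); rewrite size_takel ?szu //.
split=> //; last exact: subseq_pairwise (take_subseq _ _) uS.
rewrite {}w20 cats0 in defu; move: defu szu uS.
case: (subseq_xn w4xn) => -> {w4 w4xn w1l w1_neq0} ->.
- by rewrite cats0 => _ _; apply: subseq_trans (take_subseq _ _) w3l.
- by move=> + /pairwise_ltn_gt_last => /[swap] -> //.
- rewrite size_cat addn1 => -[<-] _; rewrite take_size_cat //.
move=> + uS; have -> // : w3 = [::].
move: uS; rewrite -[[:: x; n]]/([:: x] ++ [:: n]) catA pairwise_cat.
by case/and3P=> _ /pairwise_ltn_gt_last -> //.
Qed.

(** The last two disjuncts are due to the new ascents. A lower block of length two may be [x b],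
    under a sequence of [l]; an upper block of length two may be [x n] or [x b], and the lower block
    then consists of entries of [r] below [x], that is, of [r1 ++ r2]. *)
Lemma occ_glue_max_word (p m : nat) : occ p.+2 m.+1 w =
  [|| occ p.+2 m.+1 l, occ p.+2 m.+1 r, inc p.+1 l && inc m.+1 r,
      (m == 1) && inc p.+2 l | (p == 0) && inc m.+1 (r1 ++ r2)].
Proof.
have r_sub (s1 s2 : seq nat) : subseq s1 l -> subseq s2 r -> subseq (s1 ++ s2) w.
  move=> sl sr; rewrite /w cat_subseq // -[[:: x, n & r]]/([:: x; n] ++ r).
  exact: subseq_trans sr (suffix_subseq _ _).
apply/idP/idP => [|/or4P[| | |/orP[]]]; last first.
- case/andP=> /eqP p0 /incP[v [vr szv vS]]; apply/occP; exists [:: x; n], v; split.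
    rewrite /w -[[:: x, n & r]]/([:: x; n] ++ r) (subseq_trans _ (suffix_subseq l _)) //.
    by rewrite cat_subseq // (subseq_trans vr) // subseq_cat2l subseq_cons.
  have xn : x < n by rewrite (ltn_trans xb).
  split; rewrite ?p0 //= ?xn //; apply/allrelP=> y z; rewrite !inE => + /(mem_subseq vr)/r_lt.
  by case/orP=> /eqP->; lia.
- case/andP=> /eqP m1 /incP[u [ul szu uS]]; apply/occP; exists u, [:: x; b]; split.
    rewrite /w cat_subseq //= eqxx; rewrite /r -cat1s; case: eqP => _; last first.
      by rewrite (subseq_trans _ (suffix_subseq r1 _)) //= eqxx sub0seq.
    by apply: sub0seq.
  split; rewrite ?m1 //= ?xb //; apply/allrelP=> y z /(mem_subseq ul)/l_gt[xy by_].
  by rewrite !inE => /orP[] /eqP->.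
- case/andP=> /incP[u [ul szu uS]] /incP[v [vr szv vS]]; apply/occP; exists (rcons u n), v.
  split.
    by rewrite cat_rcons /w cat_subseq // (@subseq_trans _ (n :: r)) ?subseq_cons //= eqxx.
  split; rewrite ?size_rcons ?szu //.
    rewrite -cats1 pairwise_cat uS /= andbT; apply/allrelP=> y z /(mem_subseq ul) /l_lt.
    by rewrite inE => ? /eqP->.
  apply/allrelP=> y z; rewrite mem_rcons inE => + /(mem_subseq vr) zr.
  case/predU1P=> [->|/(mem_subseq ul) yl]; last exact: l_r.
  by case: (r_cases zr); lia.
- by apply: occ_subseq; have := r_sub [::] r (sub0seq _) (subseq_refl _).
- by apply: occ_subseq; rewrite /w prefix_subseq.
case/occP=> u [v [+ [szu szv uS vS /allrelP all_gt]]].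
move=> /subseq_catP[w3 [w' [defuv w3l]]]; rewrite -[[:: x, n & r]]/([:: x; n] ++ r).
move=> /subseq_catP[w4 [w2 [defw' w4xn w2r]]]; rewrite {}defw' in defuv.
have w1l : {subset w3 ++ w4 <= l ++ [:: x; n]} by apply: mem_subseq; rewrite cat_subseq.
have w3x : {in w3, forall z, x < z} by move=> z /(mem_subseq w3l) /l_gt[].
have u_neq0 : u != [::] by case: u szu {uS all_gt defuv}.
have v_neq0 : v != [::] by case: v szv {vS all_gt defuv}.
have inc_r12 : subseq v r -> {in v, forall z, z < x} -> inc m.+1 (r1 ++ r2).
  move=> vr vx; apply/incP; exists v; split=> //.
  apply: subseq_trans (filter_subseq (fun z => z < x) _).
  suff -> : [seq z <- r1 ++ r2 | z < x] = [seq z <- r | z < x].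
    by rewrite subseq_filter vr andbT; apply/allP.
  by rewrite !filter_cat /= ltnNge ltnW.
have inc_l : subseq u l -> inc p.+2 l by move=> ul; apply/incP; exists u.
(* The cut between the blocks falls exactly before [r]. The upper block is then a sequence of [l],
   such a sequence followed by [n], or [x n]; it cannot end in [x], as it has at least two entries
   and [l] lies above [x]. *)
have no_cross : u = w3 ++ w4 -> v = w2 ->
    [|| occ p.+2 m.+1 l, occ p.+2 m.+1 r, inc p.+1 l && inc m.+1 r,
      (m == 1) && inc p.+2 l | (p == 0) && inc m.+1 (r1 ++ r2)].
  move=> defu defv; have incv : inc m.+1 r by apply/incP; exists v; rewrite {1}defv.
  case: (subseq_xn w4xn) => w4E; rewrite {}w4E in defu.
  - apply/or4P; constructor 3; rewrite incv andbT (inc_leq _ (inc_l _)) //.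
    by rewrite defu cats0.
  - by move: uS szu; rewrite defu => /pairwise_ltn_gt_last->.
  - apply/or4P; constructor 3; rewrite incv andbT; apply/incP; exists w3; split=> //.
      by move: szu; rewrite defu size_cat addn1 => -[].
    by move: uS; rewrite defu pairwise_cat => /and3P[].
  - have w30 : w3 = [::].
      move: uS; rewrite defu -[[:: x; n]]/([:: x] ++ [:: n]) catA pairwise_cat.
      by case/and3P=> _ /pairwise_ltn_gt_last->.
    apply/or4P; constructor 4; apply/orP; right.
    move: szu; rewrite defu w30 => -[<-]; rewrite eqxx inc_r12 ?defv // => z zv.
    by rewrite all_gt ?defv // defu mem_cat mem_head orbT.
(* Either the upper block reaches into [r] with a part [z], or the lower block begins before [r]
   with a part [z]. *)
rewrite catA in defuv; case: (cat_eq_cat defuv) => -[z [defu defv]].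
  have zr : {subset z <= r} by move=> y yz; apply: (mem_subseq w2r); rewrite defv mem_cat yz.
  have [w10|w1_neq0] := eqVneq (w3 ++ w4) [::].
    apply/or4P; constructor 2; apply/occP; exists u, v; rewrite defuv w10; split=> //; split=> //.
    exact/allrelP.
  have [z0|z_neq0] := eqVneq z [::].
    by apply: no_cross; rewrite ?defu ?defv z0 ?cats0.
  case: (asc_cross w1l zr) => // [|w1E zE]; first by rewrite -defu.
  apply/or4P; constructor 4; apply/orP; right.
  rewrite w1E zE in defu; move: szu; rewrite defu => -[<-]; rewrite eqxx inc_r12 //.
    by apply: subseq_trans w2r; rewrite defv suffix_subseq.
  by move=> y yv; rewrite all_gt // defu mem_head.
have [z0|z_neq0] := eqVneq z [::].
  by apply: no_cross; [rewrite defu z0 cats0 | rewrite defv z0].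
have zS : pairwise ltn z by move: vS; rewrite defv pairwise_cat => /and3P[].
have z_lt : {in z, forall y, y < n}.
  move=> y yz; case: u u_neq0 {uS szu defuv inc_l no_cross} all_gt defu => // y0 u _ all_gt defu.
  have := all_gt y0 y (mem_head _ _); rewrite defv mem_cat yz => /(_ isT).
  move=> /leq_trans; apply; have /w1l : y0 \in w3 ++ w4 by rewrite defu mem_head.
  rewrite mem_cat !inE => /or3P[/l_lt/ltnW|/eqP->|/eqP->] //.
  by rewrite ltnW // (ltn_trans xb).
have no_n s1 : w4 = rcons s1 n -> False.
  case/lastP: z z_neq0 z_lt defu {zS defv} => // z y _ z_lt + w4E.
  rewrite w4E -!rcons_cat => /rcons_inj[_ ny].
  by have := z_lt y; rewrite mem_rcons mem_head -ny ltnn => /(_ isT).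
case: (subseq_xn w4xn) => w4E; last 2 first.
- by case: (no_n [::]).
- by case: (no_n [:: x]).
- rewrite w4E cats0 in defu.
  have ul : subseq u l by apply: subseq_trans w3l; rewrite defu prefix_subseq.
  have [w20|w2_neq0] := eqVneq w2 [::].
    apply/or4P; constructor 1; apply/occP; exists u, v; rewrite defv w20 cats0 -defu.
    split=> //; split=> //; rewrite ?defv ?w20 ?cats0 // in szv *.
    by apply/allrelP=> y y' yu yz; rewrite all_gt // defv w20 cats0.
  case: (asc_cross (u := z) _ (mem_subseq w2r)) => //; last 2 first.
  + by rewrite -defv.
  + move=> zE; have := w3x x; rewrite defu zE mem_cat mem_head orbT => /(_ isT).
    by rewrite ltnn.
  by move=> y yz; rewrite mem_cat (mem_subseq w3l) // defu mem_cat yz orbT.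
(* Here the part of the lower block before [r] ends in [x]; since [l] lies above [x], it is [x]
   alone, and it stops there or continues with [b]. *)
case/lastP: z z_neq0 zS defu defv {z_lt no_n} => // z y _ zS defu defv.
move: defu; rewrite w4E cats1 -rcons_cat => /rcons_inj[w3E xy].
have z0 : z = [::].
  apply: (pairwise_ltn_gt_last (y := x)); first by rewrite cats1 xy.
  by move=> y' yz; rewrite w3x // w3E mem_cat yz orbT.
rewrite z0 cats0 in w3E; rewrite z0 -xy /= in defv.
have inclu : inc p.+2 l by apply: inc_l; rewrite -w3E.
have [w20|w2_neq0] := eqVneq w2 [::].
  apply/or4P; constructor 3; rewrite (inc_leq _ inclu) //.
  by move: szv; rewrite defv w20 => -[<-]; rewrite inc1 /r -size_eq0 size_cat addnS.
have x_sub : {subset [:: x] <= l ++ [:: x; n]}.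
  by move=> y'; rewrite inE => /eqP->; rewrite mem_cat mem_head orbT.
have xw2 : pairwise ltn ([:: x] ++ w2) by rewrite -[X in pairwise ltn X]defv.
have [_ w2E] := asc_cross x_sub (mem_subseq w2r) xw2 isT w2_neq0.
apply/or4P; constructor 4; apply/orP; left.
by move: szv; rewrite defv w2E => -[<-]; rewrite inclu.
Qed.
End GlueMaxWord.

Section GlueMax.
Variables (a b r1 r2 : seq nat).
Hypotheses (pa : perm_eq a (iota 0 (size a))) (pb : perm_eq b (iota 0 (size b))).
Hypothesis defb : b = r1 ++ (size b).-1 :: r2.

Let j := size b.
Let n := (size a + size b).+1.

Let j_gt0 : 0 < j.
Proof. by rewrite /j defb size_cat /= addnS. Qed.

Let r_lt : {in r1 ++ r2, forall x, x < j.-1}.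
Proof.
move: pb; rewrite {1}defb -/j -{2}(prednK j_gt0) perm_iotaS_cat => /perm_iota_lt; exact.
Qed.

Let bump_b : map (bump j.-1) b = r1 ++ j :: r2.
Proof.
rewrite defb map_cat /= -/j {2}/bump leqnn add1n prednK //.
have bump_id (s : seq nat) : {subset s <= r1 ++ r2} -> map (bump j.-1) s = s.
  move=> sub; rewrite -[RHS]map_id; apply/eq_in_map=> x /sub/r_lt xj.
  by rewrite /bump leqNgt xj.
by rewrite !bump_id // => x; rewrite mem_cat => ->; rewrite ?orbT.
Qed.

Let l_gt : {in map (addn j.+1) a, forall y, j.-1 < y /\ j < y}.
Proof. by move=> _ /mapP[x _ ->]; lia. Qed.

Let l_lt : {in map (addn j.+1) a, forall y, y < n}.
Proof. by move=> _ /mapP[x /(perm_iota_lt pa) + ->]; rewrite /n /j; lia. Qed.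

Let pred_lt : j.-1 < j. Proof. by rewrite prednK. Qed.
Let lt_n : j < n. Proof. by rewrite /n /j ltnS leq_addl. Qed.

Let bump_mono : {mono bump j.-1 : x y / x < y}.
Proof. by move=> x y; rewrite !ltnNge leq_bump2. Qed.

Let add_mono : {mono addn j.+1 : x y / x < y}.
Proof. by move=> x y; rewrite ltn_add2l. Qed.

Lemma inc_glue_max (p : nat) : inc p.+3 (glue_max a b) = inc p.+2 a || inc p.+3 b.
Proof.
have := inc_glue_max_word l_gt l_lt r_lt pred_lt lt_n p.
by rewrite -bump_b !occ_map.
Qed.

Lemma inc2_glue_max : inc 2 (glue_max a b).
Proof.
apply/incP; exists [:: j.-1; n]; split=> //=; last by rewrite (ltn_trans pred_lt).
rewrite /glue_max -/j -/n (subseq_trans _ (suffix_subseq (map (addn j.+1) a) _)) //=.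
by rewrite !eqxx sub0seq.
Qed.

Lemma occ_glue_max (p m : nat) : occ p.+2 m.+1 (glue_max a b) =
  [|| occ p.+2 m.+1 a, occ p.+2 m.+1 b, inc p.+1 a && inc m.+1 b,
      (m == 1) && inc p.+2 a | (p == 0) && inc m.+1 (r1 ++ r2)].
Proof.
have := occ_glue_max_word l_gt l_lt r_lt pred_lt lt_n p m.
by rewrite -bump_b !occ_map.
Qed.

End GlueMax.

(** With an upper block of length two, avoidance depends on the suffix without its maximum; writing
    the suffix as [glue c d] expresses this by its two sides. *)
Lemma occ2_glue_max (a c d : seq nat) (m : nat) : perm_eq a (iota 0 (size a)) ->
  perm_eq c (iota 0 (size c)) -> perm_eq d (iota 0 (size d)) ->
  occ 2 m.+1 (glue_max a (glue c d)) =
  [|| occ 2 m.+1 a, occ 2 m.+1 (glue c d), inc 1 a && inc m.+1 (glue c d),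
      (m == 1) && inc 2 a | inc m.+1 c || inc m.+1 d].
Proof.
move=> pa pc pd.
have pb : perm_eq (glue c d) (iota 0 (size (glue c d))) by rewrite size_glue perm_glue.
rewrite (@occ_glue_max _ _ (map (addn (size d)) c) d) //; last by rewrite {1}/glue size_glue.
congr [|| _, _, _, _ | _].
rewrite occ_desc; last first.
  by apply/allrelP=> _ y /mapP[x _ ->] /(perm_iota_lt pd); lia.
rewrite inc0 andbT occ_map; last by move=> x y; rewrite ltn_add2l.
by case: (inc m.+1 c); case: (inc m.+1 d).
Qed.

(** * From words to permutations *)

Definition word (n : nat) (pi : 'S_n) : seq nat := [seq val (pi i) | i <- enum 'I_n].

Lemma size_word (n : nat) (pi : 'S_n) : size (word pi) = n.
Proof. by rewrite size_map size_enum_ord. Qed.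

Lemma nth_word (n : nat) (pi : 'S_n) (i : 'I_n) : nth 0 (word pi) i = pi i.
Proof. by rewrite (nth_map i) ?size_enum_ord // nth_ord_enum. Qed.

Lemma word_inj (n : nat) : injective (@word n).
Proof. by move=> pi pi' eq_w; apply/permP=> i; apply: val_inj; rewrite /= -!nth_word eq_w. Qed.

Lemma perm_word (n : nat) (pi : 'S_n) : perm_eq (word pi) (iota 0 n).
Proof.
rewrite -val_enum_ord /word (map_comp val pi) perm_map // uniq_perm ?enum_uniq //.
  by rewrite map_inj_uniq ?enum_uniq //; exact: perm_inj.
move=> i; rewrite mem_enum; apply/mapP; exists (pi^-1%g i); first by rewrite mem_enum.
by rewrite permKV.
Qed.

Lemma perm_words (n : nat) :
  perm_eq (permutations (iota 0 n)) [seq word pi | pi <- enum 'S_n].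
Proof.
have words_uniq : uniq [seq word pi | pi <- enum 'S_n].
  by rewrite map_inj_uniq ?enum_uniq //; exact: word_inj.
rewrite perm_sym uniq_perm ?permutations_uniq //.
(* Both lists are duplicate-free with [n!] entries, so one inclusion is enough. *)
have [||_ eq_mem] := uniq_min_size words_uniq (s2 := permutations (iota 0 n)).
- by move=> _ /mapP[pi _ ->]; rewrite mem_permutations perm_word.
- by rewrite size_permutations ?iota_uniq // size_iota size_map -cardE card_Sn.
exact: eq_mem.
Qed.

Lemma sum_perms132 (V : nmodType) (c n : nat) (F : seq nat -> V) :
  (\sum_(s <- perms132 c n) F s = \sum_(pi : 'S_n | n132 (word pi) == c) F (word pi))%R.
Proof.
by rewrite big_filter (perm_big _ (perm_words n)) big_map big_enum_cond.
Qed.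

(** Adding [m] modulo [p + m] carries the first [p] positions increasingly onto the top values and
    the last [m] increasingly onto the bottom ones. *)
Lemma shift_ltn (k p m i j : nat) : k = p + m -> i < k -> j < k ->
  ((i + m) %% k < (j + m) %% k) =
  if i < p then (j < p) && (i < j) else (j < p) || (i < j).
Proof.
move=> -> ik jk; have modE a : a < p + m -> (a + m) %% (p + m) = if a < p then a + m else a - p.
  move=> lt_a; case: ltnP => [ap|pa]; first by rewrite modn_small ?ltn_add2r.
  rewrite (_ : a + m = p + m + (a - p)); last by lia.
  by rewrite modnDl modn_small //; lia.
by rewrite !modE //; case: (ltnP i p); case: (ltnP j p) => /=; lia.
Qed.

Lemma pairwise_ltnP (s : seq nat) :
  reflect (forall i j, i < j -> j < size s -> nth 0 s i < nth 0 s j) (pairwise ltn s).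
Proof.
apply: (iffP (pairwiseP 0)) => [H i j ij js|H i j _ js ij]; last exact: H.
by apply: H => //; rewrite inE // (ltn_trans ij).
Qed.

Lemma skew_nthP (p m : nat) (w : seq nat) : size w = p + m ->
  skew p m (take p w) (drop p w) <->
  (forall i j, i < p + m -> j < p + m ->
     ((i + m) %% (p + m) < (j + m) %% (p + m)) = (nth 0 w i < nth 0 w j)).
Proof.
move=> sz; split=> [[szu szv /pairwise_ltnP uS /pairwise_ltnP vS /allrelP all_gt] i j ik jk|H].
  rewrite (@shift_ltn _ p m) //.
  have lt_take a b : a < b -> b < p -> nth 0 w a < nth 0 w b.
    by move=> ab bp; have := uS a b ab; rewrite szu !nth_take ?(ltn_trans ab) //; apply.
  have lt_drop a b : p <= a -> a < b -> b < p + m -> nth 0 w a < nth 0 w b.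
    move=> pa ab bp; have := vS (a - p) (b - p); rewrite szv !nth_drop.
    by rewrite !subnKC //; [apply; lia | lia].
  have gt_cross a b : a < p -> p <= b -> b < p + m -> nth 0 w b < nth 0 w a.
    move=> ap pb bp; apply: all_gt.
      by rewrite -(nth_take 0 ap) mem_nth // szu.
    by rewrite -(subnKC pb) -nth_drop mem_nth // szv; lia.
  case: (ltnP i p) => ip; case: (ltnP j p) => jp /=.
  - case: (ltngtP i j) => [ij|ji|->]; last by rewrite ltnn.
      by rewrite lt_take.
    by have := lt_take _ _ ji ip; lia.
  - by have := gt_cross i j ip jp jk; lia.
  - by rewrite gt_cross.
  - case: (ltngtP i j) => [ij|ji|->]; last by rewrite ltnn.
      by rewrite lt_drop.
    by have := lt_drop _ _ jp ji ik; lia.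
have ltE i j : i < p + m -> j < p + m -> (nth 0 w i < nth 0 w j) =
    if i < p then (j < p) && (i < j) else (j < p) || (i < j).
  by move=> ik jk; rewrite -H // (@shift_ltn _ p m).
have szu : size (take p w) = p by rewrite size_takel // sz leq_addr.
have szv : size (drop p w) = m by rewrite size_drop sz addKn.
split=> //.
- apply/pairwise_ltnP=> i j ij; rewrite szu => jp; have ip := ltn_trans ij jp.
  by rewrite !nth_take // ltE ?ip ?jp //; lia.
- apply/pairwise_ltnP=> i j ij; rewrite szv => jm.
  rewrite !nth_drop ltE ?ltn_add2l //; last exact: ltn_trans jm.
  have -> : (p + i < p) = false by rewrite ltnNge leq_addr.
  by rewrite ij orbT.
apply/allrelP=> x y /(nthP 0)[i + <-] /(nthP 0)[j + <-]; rewrite szu szv => ip jm.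
rewrite nth_take // nth_drop ltE; [|by rewrite ltn_add2l|exact: ltn_addr].
by rewrite ltnNge leq_addr ip.
Qed.

Lemma subseq_enum_ord (k n : nat) (f : 'I_k -> 'I_n) :
  (forall a b : 'I_k, a < b -> f a < f b) -> subseq [seq f a | a <- enum 'I_k] (enum 'I_n).
Proof.
move=> f_incr.
have lt_trans : transitive (fun i j : 'I_n => i < j) by move=> a b c; exact: ltn_trans.
suff -> : [seq f a | a <- enum 'I_k] = [seq i <- enum 'I_n | i \in [seq f a | a <- enum 'I_k]].
  exact: filter_subseq.
have enum_sorted q : pairwise (fun i j : 'I_q => i < j) (enum 'I_q).
  have := iota_ltn_sorted 0 q; rewrite -val_enum_ord (sorted_pairwise ltn_trans).
  by rewrite pairwise_map.
apply: (irr_sorted_eq lt_trans) => [i|||i].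
- exact: ltnn.
- rewrite (sorted_pairwise lt_trans) pairwise_map.
  by apply: sub_pairwise (enum_sorted k) => a b; exact: f_incr.
- rewrite (sorted_pairwise lt_trans); apply: subseq_pairwise (enum_sorted n).
  exact: filter_subseq.
- by rewrite mem_filter mem_enum andbT.
Qed.

Lemma avoids_word (k m n : nat) (pi : 'S_n) : m <= k ->
  avoids (shift_pattern k m) pi = ~~ occ (k - m) m (word pi).
Proof.
move=> le_mk; have kE : k - m + m = k by rewrite subnK.
rewrite /avoids; apply/eqP/negP=> [no_occ /occP[u [v [uvw uv_skew]]]|no_occ].
  have [szu szv _ _ _] := uv_skew.
  have szuv : size (u ++ v) = k - m + m by rewrite size_cat szu szv.
  have /(skew_nthP szuv) uv_nth : skew (k - m) m (take (k - m) (u ++ v)) (drop (k - m) (u ++ v)).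
    by rewrite take_size_cat // drop_size_cat.
  case/subseqP: uvw => b szb defuv; set fs := mask b (enum 'I_n).
  have defuv' : u ++ v = [seq val (pi i) | i <- fs] by rewrite defuv -map_mask.
  have szfs : size fs == k by rewrite -(size_map (fun i => val (pi i))) -defuv' szuv kE.
  have : [ffun a => tnth (Tuple szfs) a] \in occurrences (shift_pattern k m) pi.
    have nth_val (a : 'I_k) : pi (tnth (Tuple szfs) a) = nth 0 (u ++ v) a :> nat.
      rewrite defuv' (nth_map (tnth (Tuple szfs) a)) ?(eqP szfs) //.
      by congr (val (pi _)); exact: tnth_nth.
    rewrite inE; apply/andP; split; apply/forallP=> a; apply/forallP=> c; rewrite !ffunE.
      apply/implyP=> ac.
      have : pairwise (fun i j : 'I_n => i < j) fs.
        apply: (subseq_pairwise (mask_subseq _ _)).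
        have := iota_ltn_sorted 0 n; rewrite -val_enum_ord (sorted_pairwise ltn_trans).
        by rewrite pairwise_map.
      move/(pairwiseP (tnth (Tuple szfs) a))/(_ a c); rewrite !inE (eqP szfs) !ltn_ord.
      by move=> /(_ isT isT ac); rewrite -!(tnth_nth _ (Tuple szfs)).
    by rewrite !permE /= !nth_val -uv_nth ?kE.
  by rewrite no_occ inE.
apply/setP=> f; rewrite [RHS]inE; apply/negP; rewrite inE => /andP[/forallP f_incr /forallP f_pat].
case: no_occ; apply/occP; set w := [seq val (pi (f a)) | a <- enum 'I_k].
have szw : size w = k - m + m by rewrite size_map size_enum_ord kE.
exists (take (k - m) w), (drop (k - m) w); rewrite cat_take_drop; split.
  rewrite /w (map_comp (fun i => val (pi i)) f) map_subseq //; apply: subseq_enum_ord => a b ab.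
  by have /forallP/(_ b)/implyP/(_ ab) := f_incr a.
apply/(skew_nthP szw) => i j; rewrite kE => ik jk.
have nth_w (a : 'I_k) : nth 0 w a = pi (f a).
  by rewrite (nth_map a) ?size_enum_ord // nth_ord_enum.
have := forallP (f_pat (Ordinal ik)) (Ordinal jk).
by rewrite !permE /= -!nth_w => /eqP.
Qed.

Lemma count_sum_nth (P : pred nat) (s : seq nat) :
  count P s = \sum_(0 <= i < size s) P (nth 0 s i).
Proof.
by elim: s => [|a s IHs] /=; rewrite ?big_nil // big_nat_recl //= -IHs.
Qed.

Lemma inversions_filter_sum (P : pred nat) (s : seq nat) :
  inversions (filter P s) = \sum_(0 <= i < size s) \sum_(0 <= j < size s)
    [&& i < j, P (nth 0 s i), P (nth 0 s j) & nth 0 s j < nth 0 s i].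
Proof.
elim: s => [|a s IHs]; first by rewrite big_nil.
rewrite [size _]/= big_nat_recl // big_nat_recl //= add0n.
under [X in _ = _ + X]eq_bigr do rewrite big_nat_recl //= add0n.
have -> : \sum_(0 <= j < size s) [&& 0 < j.+1, P a, P (nth 0 s j) & nth 0 s j < a] =
    if P a then count (fun b => b < a) (filter P s) else 0.
  case: (P a); last by rewrite big1 // => j _; rewrite andbF.
  by rewrite count_filter count_sum_nth; apply: eq_bigr => j _ /=; rewrite andbC.
by case: (P a) => //=; rewrite -IHs.
Qed.

Lemma n132_sum (s : seq nat) :
  n132 s = \sum_(0 <= i < size s) \sum_(0 <= j < size s) \sum_(0 <= l < size s)
    [&& i < j, j < l, nth 0 s i < nth 0 s l & nth 0 s l < nth 0 s j].
Proof.
elim: s => [|a s IHs]; first by rewrite big_nil.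
rewrite [size _]/= big_nat_recl // big_nat_recl // [X in X + _ + _]big1 // add0n /=.
congr (_ + _).
  rewrite inversions_filter_sum; apply: eq_bigr => j _; rewrite big_nat_recl //= add0n.
  apply: eq_bigr => l _; rewrite ltnS; case: (j < l) => //=.
  case: (ltnP a (nth 0 s l)) => //= [al|_]; last by rewrite andbF.
  by case: (ltnP (nth 0 s l) (nth 0 s j)) => [/(ltn_trans al)->|]; rewrite ?andbF.
rewrite IHs; apply: eq_bigr => i _; rewrite big_nat_recl // [X in _ = X + _]big1 // add0n.
by apply: eq_bigr => j _; rewrite big_nat_recl //= andbF.
Qed.

Lemma forall_ord3 (P : pred 'I_3) :
  [forall a, P a] = [&& P (@Ordinal 3 0 isT), P (@Ordinal 3 1 isT) & P (@Ordinal 3 2 isT)].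
Proof.
apply/forallP/and3P => [Pall|[P0 P1 P2] [[|[|[|//]]] lt_a3]]; first by split; exact: Pall.
- by rewrite (_ : Ordinal lt_a3 = Ordinal (isT : 0 < 3)) //; apply: val_inj.
- by rewrite (_ : Ordinal lt_a3 = Ordinal (isT : 1 < 3)) //; apply: val_inj.
- by rewrite (_ : Ordinal lt_a3 = Ordinal (isT : 2 < 3)) //; apply: val_inj.
Qed.

Lemma card_occurrences_p132 (n : nat) (pi : 'S_n) : #|occurrences p132 pi| = n132 (word pi).
Proof.
rewrite n132_sum size_word big_mkord.
under eq_bigr do rewrite big_mkord; under eq_bigr do under eq_bigr do rewrite big_mkord.
(* Position maps are identified with triples of positions, which matches the triple sum of
   [n132_sum]. *)
pose g (q : 'I_n * 'I_n * 'I_n) : {ffun 'I_3 -> 'I_n} :=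
  [ffun a : 'I_3 => tnth [tuple q.1.1; q.1.2; q.2] a].
have g_inj : injective g.
  move=> [[i j] l] [[i' j'] l'] eq_g.
  have eq_at a := congr1 (fun f : {ffun _ -> _} => f a) eq_g.
  have := eq_at (@Ordinal 3 0 isT); have := eq_at (@Ordinal 3 1 isT).
  have := eq_at (@Ordinal 3 2 isT).
  by rewrite !ffunE !(tnth_nth i) /= => -> -> ->.
pose C := [set q : 'I_n * 'I_n * 'I_n |
  [&& q.1.1 < q.1.2, q.1.2 < q.2, pi q.1.1 < pi q.2 & pi q.2 < pi q.1.2]].
have p132_0 : p132 (@Ordinal 3 0 isT) = @Ordinal 3 0 isT by rewrite permE.
have p132_1 : p132 (@Ordinal 3 1 isT) = @Ordinal 3 2 isT by rewrite permE.
have p132_2 : p132 (@Ordinal 3 2 isT) = @Ordinal 3 1 isT by rewrite permE.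
have -> : occurrences p132 pi = g @: C.
  apply/setP=> f.
  have -> : f = g (f (@Ordinal 3 0 isT), f (@Ordinal 3 1 isT), f (@Ordinal 3 2 isT)).
    apply/ffunP=> a; rewrite ffunE (tnth_nth (f a)) /=.
    by case: a => -[|[|[|//]]] lt_a3 /=; congr (f _); apply: val_inj.
  rewrite mem_imset // !inE /occurrence !forall_ord3 p132_0 p132_1 p132_2 /= !ffunE /tnth /=.
  by move: (f _) (f _) (f _) => a b c; rewrite !ltnn /=; lia.
rewrite card_imset // -sum1_card pair_big pair_big /= big_mkcond /=.
apply: eq_bigr => -[[i j] l] _; rewrite inE /= -!nth_word.
by case: ifP.
Qed.

(** * Formal power series *)

Local Open Scope ring_scope.

Definition series (R : Type) := nat -> R.

HB.instance Definition _ (R : Type) := gen_eqMixin (series R).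
HB.instance Definition _ (R : Type) := gen_choiceMixin (series R).

Section SeriesRing.
Variable R : comNzRingType.
Implicit Types f g h : series R.

Definition sadd f g : series R := fun n => f n + g n.
Definition sopp f : series R := fun n => - f n.
Definition szero : series R := fun n => 0.
Definition sone : series R := fun n => (n == 0%N)%:R.
Definition smul f g : series R := fun n => \sum_(i < n.+1) f i * g (n - i)%N.

Fact saddA : associative sadd.
Proof. by move=> f g h; apply/funext=> n; rewrite /sadd addrA. Qed.
Fact saddC : commutative sadd.
Proof. by move=> f g; apply/funext=> n; rewrite /sadd addrC. Qed.
Fact sadd0 : left_id szero sadd.
Proof. by move=> f; apply/funext=> n; rewrite /sadd add0r. Qed.
Fact saddN : left_inverse szero sopp sadd.
Proof. by move=> f; apply/funext=> n; rewrite /sadd addNr. Qed.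

HB.instance Definition _ := GRing.isZmodule.Build (series R) saddA saddC sadd0 saddN.

(** A coefficient of a product depends on finitely many coefficients, so the ring laws of series are
    inherited from truncating polynomials. *)
Let smul_trunc N f g n : (n < N)%N ->
  smul f g n = (\poly_(i < N) f i * \poly_(i < N) g i)`_n.
Proof.
move=> lt_nN; rewrite coefM; apply: eq_bigr => i _.
by rewrite !coef_poly !ifT // (leq_ltn_trans _ lt_nN) ?leq_subr // -ltnS.
Qed.

Fact smulC : commutative smul.
Proof. by move=> f g; apply/funext=> n; rewrite !(smul_trunc _ _ (ltnSn n)) mulrC. Qed.

Fact smulA : associative smul.
Proof.
move=> f g h; apply/funext=> n.
have trunc_mul u v w : smul (smul u v) w n =
    (\poly_(i < n.+1) u i * \poly_(i < n.+1) v i * \poly_(i < n.+1) w i)`_n.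
  rewrite [RHS]coefM; apply: eq_bigr => i _; rewrite (smul_trunc _ _ (ltn_ord i)).
  by rewrite [in RHS]coef_poly ifT // ltnS leq_subr.
by rewrite smulC !trunc_mul mulrC mulrA.
Qed.

Fact smul1 : left_id sone smul.
Proof.
move=> f; apply/funext=> n; rewrite /smul big_ord_recl /sone mul1r subn0.
by rewrite big1 ?addr0 // => i _; rewrite mul0r.
Qed.

Fact smulDl : left_distributive smul sadd.
Proof.
by move=> f g h; apply/funext=> n; rewrite /sadd -big_split; apply: eq_bigr => i _; exact: mulrDl.
Qed.

Fact sone_neq0 : sone != szero.
Proof.
by apply/eqP=> /(congr1 (fun f : series R => f 0%N)) /eqP; rewrite /sone /szero oner_eq0.
Qed.

HB.instance Definition _ := GRing.Zmodule_isComNzRing.Build (series R)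
  smulA smulC smul1 smulDl sone_neq0.

Lemma coef_seriesM f g n : (f * g) n = \sum_(i < n.+1) f i * g (n - i)%N.
Proof. by []. Qed.

Lemma coef_seriesD f g n : (f + g) n = f n + g n. Proof. by []. Qed.

Definition series_of_poly (p : {poly R}) : series R := fun n => p`_n.

Fact series_of_poly_is_zmod_morphism : zmod_morphism series_of_poly.
Proof. by move=> p q; apply/funext=> n; rewrite /series_of_poly coefB. Qed.

Fact series_of_poly_is_monoid_morphism : monoid_morphism series_of_poly.
Proof.
split; first by apply/funext=> n; rewrite /series_of_poly coef1.
by move=> p q; apply/funext=> n; rewrite /series_of_poly coefM.
Qed.

HB.instance Definition _ := GRing.isZmodMorphism.Build {poly R} (series R)
  series_of_poly series_of_poly_is_zmod_morphism.
HB.instance Definition _ := GRing.isMonoidMorphism.Build {poly R} (series R)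
  series_of_poly series_of_poly_is_monoid_morphism.

Definition seriesX : series R := series_of_poly 'X.

Lemma coef_seriesXM f n : (seriesX * f) n = if n is n'.+1 then f n' else 0.
Proof.
rewrite coef_seriesM; case: n => [|n].
  by rewrite big_ord1 /seriesX /series_of_poly coefX mul0r.
rewrite big_ord_recl big_ord_recl big1 => [|i _].
  by rewrite /seriesX /series_of_poly !coefX mul0r add0r addr0 mul1r subSS subn0.
by rewrite /seriesX /series_of_poly coefX mul0r.
Qed.

End SeriesRing.

(** Coefficient [n] of [e * f] is [e 0 * f n] plus terms in earlier coefficients of [f], which agree
    by induction. *)
Lemma mul_series_inj (R : idomainType) (e f g : series R) :
  e 0%N != 0 -> e * f = e * g -> f = g.
Proof.
move=> e0 eq_ef; apply/funext=> n; elim/ltn_ind: n => n IHn.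
have := congr1 (fun f : series R => f n) eq_ef.
rewrite !coef_seriesM !big_ord_recl !subn0.
rewrite (eq_bigr (fun i : 'I_n => e (lift ord0 i) * g (n - lift ord0 i)%N)).
  by move=> /addIr /(mulfI e0).
by case=> i lt_in _ /=; rewrite IHn // ltn_subrL /= (leq_ltn_trans _ lt_in).
Qed.

(** * Equations for the generating functions *)

Definition wsum (L : nat -> seq (seq nat)) (F : seq nat -> rat) : series rat :=
  fun n => \sum_(s <- L n) F s.

Lemma wsum_glues (op : seq nat -> seq nat -> seq nat) (L1 L2 : nat -> seq (seq nat))
    (F f1 g1 f2 g2 : seq nat -> rat) :
  (forall (i j : nat) (a b : seq nat), a \in L1 i -> b \in L2 j ->
    F (op a b) = f1 a * g1 b + f2 a * g2 b) ->
  wsum (glues op L1 L2) F = wsum L1 f1 * wsum L2 g1 + wsum L1 f2 * wsum L2 g2.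
Proof.
move=> defF; apply/funext=> n.
rewrite coef_seriesD !coef_seriesM -big_split /wsum sum_glues.
apply: eq_bigr => i _ /=; rewrite !big_distrl -big_split /=.
apply: eq_big_seq => a aL1; rewrite !big_distrr -big_split /=.
by apply: eq_big_seq => b bL2; exact: defF aL1 bL2.
Qed.

Lemma wsum_perms132_0 (F : seq nat -> rat) : wsum (perms132 0) F =
  series_of_poly (F [::])%:P + @seriesX _ * wsum (glues glue (perms132 0) (perms132 0)) F.
Proof.
apply/funext=> -[|n]; rewrite coef_seriesD coef_seriesXM /series_of_poly coefC /=.
  by rewrite addr0 /wsum big_seq1.
by rewrite add0r /wsum (perm_big _ (perms132_0S n)).
Qed.

Lemma wsum_perms132_1 (F : seq nat -> rat) : wsum (perms132 1) F =
  @seriesX _ * (wsum (glues glue (perms132 1) (perms132 0)) F +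
                wsum (glues glue (perms132 0) (perms132 1)) F +
                @seriesX _ * wsum (glues glue_max (perms132 0) perms132_pos) F).
Proof.
apply/funext=> -[|n]; rewrite coef_seriesXM; first by rewrite /wsum big_nil.
rewrite {1}/wsum (perm_big _ (perms132_1S n)) !big_cat /= addrA !coef_seriesD coef_seriesXM.
by case: n => [|n] //; rewrite [X in _ + X = _]big_nil.
Qed.

Lemma wsum_perms132_pos (F : seq nat -> rat) :
  wsum perms132_pos F = wsum (perms132 0) F - series_of_poly (F [::])%:P.
Proof.
apply/eqP; rewrite eq_sym subr_eq addrC; apply/eqP/funext=> -[|n].
  by rewrite coef_seriesD /series_of_poly coefC /wsum big_seq1 big_nil addr0.
by rewrite coef_seriesD /series_of_poly coefC add0r.
Qed.

Lemma wsumB L (f g : seq nat -> rat) :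
  wsum L (fun s => f s - g s) = wsum L f - wsum L g.
Proof.
apply/eqP; rewrite eq_sym subr_eq; apply/eqP/funext=> n.
by rewrite coef_seriesD -big_split; apply: eq_bigr => s _; rewrite /= subrK.
Qed.

Lemma wsum0 L : wsum L (fun _ => 0) = 0.
Proof. by apply/funext=> n; rewrite /wsum big1. Qed.

Definition indic (b : bool) : rat := b%:R.

(* Generating functions of the words avoiding [p + m, m] and containing 132 not
   at all, respectively once. *)
Definition av_gf (p m : nat) : series rat := wsum (perms132 0) (fun s => indic (~~ occ p m s)).
Definition once_gf (p m : nat) : series rat := wsum (perms132 1) (fun s => indic (~~ occ p m s)).

Local Notation X := (@seriesX rat).

Lemma wsum_av_glue (F f1 g1 f2 g2 : seq nat -> rat) :
  (forall a b, perm_eq a (iota 0 (size a)) -> perm_eq b (iota 0 (size b)) ->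
    F (glue a b) = f1 a * g1 b + f2 a * g2 b) ->
  wsum (perms132 0) F = series_of_poly (F [::])%:P +
    X * (wsum (perms132 0) f1 * wsum (perms132 0) g1 +
         wsum (perms132 0) f2 * wsum (perms132 0) g2).
Proof.
move=> defF; rewrite {1}wsum_perms132_0 (@wsum_glues _ _ _ _ f1 g1 f2 g2) //.
by move=> i j a b /perm_perms132 pa /perm_perms132; exact: defF.
Qed.

(** In the exceptional case the suffix is nonempty: this explains the subtracted constants, and it
    allows the weight to be checked on suffixes of the form [glue c d] only. *)
Lemma wsum_once_glue (F f1 g1 f2 g2 e1 k1 e2 k2 : seq nat -> rat) :
  (forall a b, perm_eq a (iota 0 (size a)) -> perm_eq b (iota 0 (size b)) ->
    F (glue a b) = f1 a * g1 b + f2 a * g2 b) ->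
  (forall a c d, perm_eq a (iota 0 (size a)) -> perm_eq c (iota 0 (size c)) ->
      perm_eq d (iota 0 (size d)) ->
    F (glue_max a (glue c d)) = e1 a * k1 (glue c d) + e2 a * k2 (glue c d)) ->
  wsum (perms132 1) F =
    X * (wsum (perms132 1) f1 * wsum (perms132 0) g1 +
         wsum (perms132 1) f2 * wsum (perms132 0) g2 +
         (wsum (perms132 0) f1 * wsum (perms132 1) g1 +
          wsum (perms132 0) f2 * wsum (perms132 1) g2) +
         X * (wsum (perms132 0) e1 * (wsum (perms132 0) k1 - series_of_poly (k1 [::])%:P) +
              wsum (perms132 0) e2 * (wsum (perms132 0) k2 - series_of_poly (k2 [::])%:P))).
Proof.
move=> defF defFmax; rewrite {1}wsum_perms132_1 -!wsum_perms132_pos.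
have gl (c d : nat) : wsum (glues glue (perms132 c) (perms132 d)) F =
    wsum (perms132 c) f1 * wsum (perms132 d) g1 + wsum (perms132 c) f2 * wsum (perms132 d) g2.
  apply: wsum_glues => i j a b /perm_perms132 pa /perm_perms132; exact: defF.
rewrite !gl; congr (_ * (_ + _ * _)).
apply: wsum_glues => i j a b /perm_perms132 pa.
rewrite mem_perms132_pos => /andP[]; case: j => // j _.
rewrite (perm_mem (perms132_0S j)) => /mem_glues[c [d [-> _ _ pc pd]]].
exact: defFmax.
Qed.

Lemma av_gf_00 : av_gf 0 0 = 0.
Proof. by apply/funext=> n; rewrite /av_gf /wsum big1 // => s _; rewrite inc0. Qed.

Lemma once_gf_00 : once_gf 0 0 = 0.
Proof. by apply/funext=> n; rewrite /once_gf /wsum big1 // => s _; rewrite inc0. Qed.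

Lemma indic_occ_nil (p m : nat) : (0 < p + m)%N -> indic (~~ occ p m [::]) = 1.
Proof. by case: (boolP (occ p m [::])) => // /occ_size /=; case: (p + m)%N. Qed.

Lemma av_gf_inc (p : nat) : av_gf p.+1 0 = 1 + X * (av_gf p 0 * av_gf p.+1 0).
Proof.
rewrite {1}/av_gf (wsum_av_glue (f1 := fun a => indic (~~ occ p 0 a))
  (g1 := fun b => indic (~~ occ p.+1 0 b)) (f2 := fun=> 0) (g2 := fun=> 0)).
  by rewrite indic_occ_nil // polyC1 rmorph1 wsum0 mul0r addr0.
move=> a b pa pb; rewrite (inc_glue _ pa pb) mul0r addr0 /indic negb_or.
by case: (occ p 0 a); rewrite ?mul0r ?mul1r.
Qed.

(** The split is on [C], that the left part has the increasing sequence. Without it [A] fails too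
    and only [B] matters; with it [D] must fail, which already excludes [B]. *)
Lemma indic_split (A B C D : bool) : (A -> C) -> (B -> D) ->
  indic (~~ [|| A, B | C && D]) =
    indic (~~ C) * indic (~~ B) + (indic (~~ A) - indic (~~ C)) * indic (~~ D).
Proof.
case: A; case: B; case: C; case: D => //= hAC hBD; rewrite /indic;
  by [move: (hAC isT) | move: (hBD isT) |
      rewrite ?(mul0r, mulr0, mul1r, mulr1, subrr, subr0, addr0, add0r)].
Qed.

Lemma indic_occ_glue (p m : nat) (a b : seq nat) :
  perm_eq a (iota 0 (size a)) -> perm_eq b (iota 0 (size b)) ->
  indic (~~ occ p.+1 m.+1 (glue a b)) =
    indic (~~ occ p 0 a) * indic (~~ occ p.+1 m.+1 b) +
    (indic (~~ occ p.+1 m.+1 a) - indic (~~ occ p 0 a)) * indic (~~ occ m.+1 0 b).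
Proof.
move=> pa pb; rewrite (occ_glue _ _ pa pb); apply: indic_split.
  by move/occ_incl; exact: inc_leq.
exact: occ_incr.
Qed.

Lemma av_gf_occ (p m : nat) : av_gf p.+1 m.+1 =
  1 + X * (av_gf p 0 * av_gf p.+1 m.+1 + (av_gf p.+1 m.+1 - av_gf p 0) * av_gf m.+1 0).
Proof.
by rewrite {1}/av_gf (wsum_av_glue (indic_occ_glue p m)) wsumB indic_occ_nil // polyC1 rmorph1.
Qed.

(** The exceptional case contributes nothing here: the entry before the maximum and the maximum
    already form an increasing pair. *)
Lemma once_gf_inc12 (p : nat) : (p < 2)%N ->
  once_gf p.+1 0 = X * (once_gf p 0 * av_gf p.+1 0 + av_gf p 0 * once_gf p.+1 0).
Proof.
move=> p2; rewrite {1}/once_gf (wsum_once_glue (f1 := fun a => indic (~~ occ p 0 a))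
  (g1 := fun b => indic (~~ occ p.+1 0 b)) (f2 := fun=> 0) (g2 := fun=> 0)
  (e1 := fun=> 0) (k1 := fun=> 0) (e2 := fun=> 0) (k2 := fun=> 0)).
- by rewrite !wsum0 !mul0r !addr0 mulr0 addr0.
- move=> a b pa pb; rewrite (inc_glue _ pa pb) mul0r addr0 /indic negb_or.
  by case: (occ p 0 a); rewrite ?mul0r ?mul1r.
- move=> a c d pa pc pd; rewrite !mul0r addr0 /indic.
  suff -> : occ p.+1 0 (glue_max a (glue c d)) by [].
  apply: (@inc_leq _ 2) => //; apply: (@inc2_glue_max a _ (map (addn (size d)) c) d).
  by rewrite size_glue.
Qed.

Lemma once_gf_inc (p : nat) : once_gf p.+3 0 =
  X * (once_gf p.+2 0 * av_gf p.+3 0 + av_gf p.+2 0 * once_gf p.+3 0 +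
       X * (av_gf p.+2 0 * (av_gf p.+3 0 - 1))).
Proof.
rewrite {1}/once_gf (wsum_once_glue (f1 := fun a => indic (~~ occ p.+2 0 a))
  (g1 := fun b => indic (~~ occ p.+3 0 b)) (f2 := fun=> 0) (g2 := fun=> 0)
  (e1 := fun a => indic (~~ occ p.+2 0 a)) (k1 := fun b => indic (~~ occ p.+3 0 b))
  (e2 := fun=> 0) (k2 := fun=> 0)).
- by rewrite !wsum0 !mul0r !addr0 indic_occ_nil // polyC1 rmorph1.
- move=> a b pa pb; rewrite (inc_glue _ pa pb) mul0r addr0 /indic negb_or.
  by case: (occ p.+2 0 a); rewrite ?mul0r ?mul1r.
- move=> a c d pa pc pd; rewrite mul0r addr0 /indic.
  have pb : perm_eq (glue c d) (iota 0 (size (glue c d))) by rewrite size_glue perm_glue.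
  rewrite (@inc_glue_max a _ (map (addn (size d)) c) d) //; last by rewrite size_glue.
  by rewrite negb_or; case: (occ p.+2 0 a); rewrite ?mul0r ?mul1r.
Qed.

(** The part of the equation shared by all patterns with two nonempty blocks: the occurrence of 132
    lies left of the maximum in the first line, right of it in the second. *)
Definition once_desc (p m : nat) : series rat :=
  once_gf p 0 * av_gf p.+1 m + (once_gf p.+1 m - once_gf p 0) * av_gf m 0 +
  (av_gf p 0 * once_gf p.+1 m + (av_gf p.+1 m - av_gf p 0) * once_gf m 0).

Lemma perm_glue_size (c d : seq nat) :
  perm_eq c (iota 0 (size c)) -> perm_eq d (iota 0 (size d)) ->
  perm_eq (glue c d) (iota 0 (size (glue c d))).
Proof. by move=> pc pd; rewrite size_glue perm_glue. Qed.

(** No block has length two except possibly inside a side, so the new ascents of [glue_max] are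
    harmless and the exceptional case obeys the same split as [glue], with [inc p.+2] on the
    prefix. *)
Lemma once_gf_occ (p m : nat) : m != 1%N -> once_gf p.+3 m.+1 =
  X * (once_desc p.+2 m.+1 +
       X * (av_gf p.+2 0 * (av_gf p.+3 m.+1 - 1) +
            (av_gf p.+3 m.+1 - av_gf p.+2 0) * (av_gf m.+1 0 - 1))).
Proof.
move=> m1; rewrite {1}/once_gf (wsum_once_glue (indic_occ_glue p.+2 m)
  (e1 := fun a => indic (~~ occ p.+2 0 a)) (k1 := fun b => indic (~~ occ p.+3 m.+1 b))
  (e2 := fun a => indic (~~ occ p.+3 m.+1 a) - indic (~~ occ p.+2 0 a))
  (k2 := fun b => indic (~~ occ m.+1 0 b))).
  by rewrite !wsumB !indic_occ_nil // polyC1 rmorph1.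
move=> a c d pa pc pd; have pb := perm_glue_size pc pd.
rewrite (@occ_glue_max a _ (map (addn (size d)) c) d) //; last by rewrite size_glue.
rewrite (negPf m1) /= orbF; apply: indic_split; last exact: occ_incr.
by move/occ_incl; exact: inc_leq.
Qed.

(** The ascent from the inserted entry to the largest entry of the suffix is a complete lower block,
    so the prefix has to avoid its upper block: [av_gf p.+3 0] replaces [av_gf p.+3 2] in the last
    product. *)
Lemma once_gf_occ2 (p : nat) : once_gf p.+3 2 =
  X * (once_desc p.+2 2 +
       X * (av_gf p.+2 0 * (av_gf p.+3 2 - 1) + (av_gf p.+3 0 - av_gf p.+2 0) * (av_gf 2 0 - 1))).
Proof.
rewrite {1}/once_gf (wsum_once_glue (indic_occ_glue p.+2 1)
  (e1 := fun a => indic (~~ occ p.+2 0 a)) (k1 := fun b => indic (~~ occ p.+3 2 b))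
  (e2 := fun a => indic (~~ occ p.+3 0 a) - indic (~~ occ p.+2 0 a))
  (k2 := fun b => indic (~~ occ 2 0 b))).
  by rewrite !wsumB !indic_occ_nil // polyC1 rmorph1.
move=> a c d pa pc pd; have pb := perm_glue_size pc pd.
rewrite (@occ_glue_max a _ (map (addn (size d)) c) d) //; last by rewrite size_glue.
rewrite /= orbF -indic_split; last exact: occ_incr; last exact: inc_leq.
have := @occ_incl p.+3 2 a; case: (occ p.+3 2 a); case: (occ p.+3 0 a); rewrite ?orbT ?orbF //.
by move/(_ isT).
Qed.

(** The inserted entry and the maximum form a complete upper block, so the two sides of the maximum
    of the suffix must each avoid the lower block. The summand 1 is the weight at an empty suffix,
    where [glue_max [::] [::]] is a word of length two, too short for the pattern. *)
Lemma av_gf_glue_max_nil (m : nat) :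
  wsum (perms132 0) (fun b => indic (~~ occ 2 m.+1 (glue_max [::] b))) =
  1 + X * (av_gf m.+1 0 * av_gf m.+1 0).
Proof.
rewrite (wsum_av_glue (f1 := fun c => indic (~~ occ m.+1 0 c))
  (g1 := fun d => indic (~~ occ m.+1 0 d)) (f2 := fun=> 0) (g2 := fun=> 0)).
  rewrite wsum0 mul0r addr0; congr (_ + _).
  have -> : occ 2 m.+1 (glue_max [::] [::]) = false.
    by apply/negbTE/negP=> /occ_size.
  by rewrite /indic polyC1 rmorph1.
move=> c d pc pd; rewrite mul0r addr0 occ2_glue_max // (occ_glue _ _ pc pd).
have -> : occ 2 m.+1 [::] = false by apply/negbTE/negP=> /occ_size.
have -> : occ 2 0 [::] = false by apply/negbTE/negP=> /occ_size.
rewrite (inc1 [::]) /= andbF /indic; move: (@occ_incr 2 m.+1 c) (@occ_incr 2 m.+1 d).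
case: (occ 2 m.+1 c); case: (occ 2 m.+1 d); case: (occ m.+1 0 c); case: (occ m.+1 0 d);
  rewrite ?orbT ?andbF ?mulr1 ?mulr0 //=.
all: try by move=> /(_ isT).
all: by move=> _ /(_ isT).
Qed.

(** In the exceptional case the prefix is empty: an entry of it, the maximum and an entry of the
    suffix would form 231. The indicator of avoiding [inc 1] expresses this. *)
Lemma once_gf_21 :
  once_gf 2 1 = X * (once_desc 1 1 + X * (av_gf 1 0 * (X * (av_gf 1 0 * av_gf 1 0)))).
Proof.
rewrite {1}/once_gf (wsum_once_glue (indic_occ_glue 1 0)
  (e1 := fun a => indic (~~ occ 1 0 a)) (k1 := fun b => indic (~~ occ 2 1 (glue_max [::] b)))
  (e2 := fun=> 0) (k2 := fun=> 0)).
  have -> : occ 2 1 (glue_max [::] [::]) = false by apply/negbTE/negP=> /occ_size.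
  rewrite !wsumB wsum0 av_gf_glue_max_nil mul0r addr0 /indic polyC1 rmorph1.
  by rewrite [1 + _]addrC addrK.
move=> a c d pa pc pd; have pb := perm_glue_size pc pd.
rewrite mul0r addr0 !occ2_glue_max // !inc1 /=.
have -> : occ 2 1 [::] = false by apply/negbTE/negP=> /occ_size.
have -> : glue c d != [::] by apply/eqP=> /(congr1 size); rewrite size_glue.
rewrite andbT /indic; case: eqP => [->|_] /=; last by rewrite !orbT mul0r.
have -> : occ 2 1 [::] = false by apply/negbTE/negP=> /occ_size.
by rewrite mul1r.
Qed.

(** An empty prefix leaves the condition of [av_gf_glue_max_nil] on the suffix. With a nonempty
    prefix, both prefix and suffix must avoid 12, and then no occurrence is left; the difference
    [av_gf 2 0 - av_gf 1 0] counts such prefixes. *)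
Lemma once_gf_22 :
  once_gf 2 2 = X * (once_desc 1 2 + X * (av_gf 1 0 * (X * (av_gf 2 0 * av_gf 2 0)) +
  (av_gf 2 0 - av_gf 1 0) * (av_gf 2 0 - 1))).
Proof.
rewrite {1}/once_gf (wsum_once_glue (indic_occ_glue 1 1)
  (e1 := fun a => indic (~~ occ 1 0 a)) (k1 := fun b => indic (~~ occ 2 2 (glue_max [::] b)))
  (e2 := fun a => indic (~~ occ 2 0 a) - indic (~~ occ 1 0 a))
  (k2 := fun b => indic (~~ occ 2 0 b))).
  have -> : occ 2 2 (glue_max [::] [::]) = false by apply/negbTE/negP=> /occ_size.
  rewrite !wsumB av_gf_glue_max_nil !indic_occ_nil // /indic polyC1 rmorph1.
  by rewrite [1 + _]addrC addrK.
move=> a c d pa pc pd; have pb := perm_glue_size pc pd.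
rewrite !occ2_glue_max // !inc1 /= /indic.
have -> : occ 2 2 [::] = false by apply/negbTE/negP=> /occ_size.
have -> : occ 2 0 [::] = false by apply/negbTE/negP=> /occ_size.
have := @occ_incl 2 2 a; have := @occ_incr 2 2 (glue c d).
have := @inc_glue _ _ 1 _ _ pc pd; rewrite inc1.
have := @inc_leq 1 2 c isT; rewrite inc1.
have [->|a_neq0] := eqVneq a [::].
  have -> : occ 2 2 [::] = false by apply/negbTE/negP=> /occ_size.
  have -> : occ 2 0 [::] = false by apply/negbTE/negP=> /occ_size.
  by move=> *; rewrite subrr mul0r addr0 mul1r.
case: (occ 2 2 (glue c d)); case: (occ 2 0 (glue c d)); case: (c != [::]); case: (occ 2 0 c);
  case: (occ 2 0 d); case: (occ 2 2 a); case: (occ 2 0 a);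
  rewrite ?orbT ?orbF ?(mul0r, mulr0, mulr1, subr0, add0r) //= => H1 H2 H3 H4.
all: try by move: (H1 isT).
all: try by move: (H3 isT).
all: try by move: (H4 isT).
Qed.

(** * Solving the equations *)

Lemma once_gf_h (k m : nat) : (m <= k)%N ->
  once_gf (k - m) m = (fun n => (h (shift_pattern k m) n)%:R).
Proof.
move=> le_mk; apply/funext=> n; rewrite /once_gf /wsum sum_perms132 /h -sum1dep_card natr_sum.
rewrite big_mkcond [RHS]big_mkcond; apply: eq_bigr => pi _.
rewrite avoids_word // /contains_once card_occurrences_p132 /indic andbC.
by case: (n132 (word pi) == 1%N); case: (occ _ _ _).
Qed.

(** * Chebyshev polynomials scaled to polynomials in [x] *)

Section Cheb.
Variables (R : comNzRingType) (y : R).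

Fixpoint cheb_pair (n : nat) : R * R :=
  if n is n'.+1 then let: (u, v) := cheb_pair n' in (v, v - y * u) else (1, 1).

(* cheb n = y^(n/2) U_n(1 / (2 sqrt y)), a polynomial in y. *)
Definition cheb (n : nat) : R := (cheb_pair n).1.

Lemma cheb0 : cheb 0 = 1. Proof. by []. Qed.
Lemma cheb1 : cheb 1 = 1. Proof. by []. Qed.
Lemma chebSS (n : nat) : cheb n.+2 = cheb n.+1 - y * cheb n.
Proof. by rewrite /cheb /=; case: (cheb_pair n). Qed.

(* cheb_sum q is the sum of y^(q + 3) U_j(1 / (2 sqrt y))^2 over 1 <= j <= q. *)
Fixpoint cheb_sum (q : nat) : R :=
  if q is q'.+1 then y * cheb_sum q' + y ^+ 3 * cheb q ^+ 2 else 0.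

(** Scaled form of [U_(a+1) U_(b+1) - U_a U_b = U_(a+b+2)]; the recurrence has order two, so the
    induction carries two consecutive values of [a]. *)
Lemma chebD (a b : nat) : cheb a.+1 * cheb b.+1 - y * (cheb a * cheb b) = cheb (a + b).+2.
Proof.
suff: cheb a.+1 * cheb b.+1 - y * (cheb a * cheb b) = cheb (a + b).+2 /\
      cheb a.+2 * cheb b.+1 - y * (cheb a.+1 * cheb b) = cheb (a + b).+3 by case.
elim: a => [|a [IH1 IH2]].
  by rewrite !add0n !chebSS cheb0 cheb1; split; ring.
split; first exact: IH2.
rewrite !addSn [cheb (a + b).+4]chebSS -IH1 -IH2 [cheb a.+3]chebSS [cheb a.+2]chebSS; ring.
Qed.

(** By the recurrence, passing from [a] to [a.+1] multiplies the left side by [y]. *)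
Lemma cheb_cross (a d : nat) :
  cheb (a + d).+1 * cheb a.+1 - cheb (a + d).+2 * cheb a = y ^+ a.+1 * cheb d.
Proof.
elim: a => [|a IHa]; first by rewrite add0n chebSS cheb0 cheb1; ring.
rewrite addSn exprS -mulrA -IHa [cheb a.+2]chebSS [cheb (a + d).+3]chebSS; ring.
Qed.

End Cheb.

Lemma rmorph_cheb (R S : comNzRingType) (f : {rmorphism R -> S}) (y : R) (n : nat) :
  f (cheb y n) = cheb (f y) n.
Proof.
suff: f (cheb y n) = cheb (f y) n /\ f (cheb y n.+1) = cheb (f y) n.+1 by case.
elim: n => [|n [IH1 IH2]]; first by rewrite rmorph1.
by rewrite !chebSS rmorphB rmorphM IH1 IH2.
Qed.

Lemma rmorph_cheb_sum (R S : comNzRingType) (f : {rmorphism R -> S}) (y : R) (q : nat) :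
  f (cheb_sum y q) = cheb_sum (f y) q.
Proof.
elim: q => [|q IHq] /=; first by rewrite rmorph0.
by rewrite rmorphD (rmorphM _ y) IHq (rmorphM _ (y ^+ 3)) !rmorphXn rmorph_cheb.
Qed.

Local Notation P := (cheb X).

Lemma cheb_series0 (n : nat) : P n 0%N = 1.
Proof.
suff: P n 0%N = 1 /\ P n.+1 0%N = 1 by case.
elim: n => [|n [IH1 IH2]]; first by [].
split=> //; rewrite chebSS -mulN1r mulrCA coef_seriesD coef_seriesXM IH2; ring.
Qed.

Lemma av_gf_inc_cheb (p : nat) : P p.+1 * av_gf p.+1 0 = P p.
Proof.
elim: p => [|p IHp]; first by rewrite av_gf_inc av_gf_00 cheb0 cheb1; ring.
rewrite [P p.+2]chebSS mulrBl -IHp {1}av_gf_inc; ring.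
Qed.

(** Multiplied by [P p.+1 * P m.+1], the coefficient of the unknown becomes [P (p + m).+3] by
    [chebD]. The result depends on the length of the pattern alone. *)
Lemma av_gf_occ_cheb (p m : nat) : P (p + m).+3 * av_gf p.+2 m.+1 = P (p + m).+2.
Proof.
set G := av_gf p.+2 m.+1; have eqG : G = _ := av_gf_occ p.+1 m; rewrite -/G in eqG.
have PI := av_gf_inc_cheb p; have PK := av_gf_inc_cheb m.
have PG : P p.+1 * P m.+1 * G = P p.+1 * P m.+1 + X * (P p * P m.+1 * G +
    (P p.+1 * P m * G - P p * P m)).
  by rewrite {1}eqG -PI -PK; ring.
rewrite -[(p + m).+3]/((p.+1 + m).+2) -chebD -[P (p + m).+2]chebD [P p.+2]chebSS.
transitivity (P p.+1 * P m.+1 * G - X * (P p * P m.+1 * G + P p.+1 * P m * G)); first ring.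
by rewrite PG; ring.
Qed.

Lemma once_gf_10 : once_gf 1 0 = 0.
Proof. by rewrite once_gf_inc12 // once_gf_00 av_gf_00; ring. Qed.

Lemma once_gf_20 : once_gf 2 0 = 0.
Proof.
apply: (@mul_series_inj _ (P 2)); first by rewrite cheb_series0 oner_neq0.
have PI := av_gf_inc_cheb 0; rewrite cheb0 cheb1 mul1r in PI.
by rewrite chebSS cheb0 cheb1 mulrBl {1}once_gf_inc12 // once_gf_10 PI; ring.
Qed.

(** Since [P q.+3 = P q.+2 * (1 - X * av_gf q.+2 0)], multiplying the equation by [P q.+3 ^+ 2]
    yields the recursion of [cheb_sum]. *)
Lemma once_gf_inc_cheb (q : nat) : P q.+2 ^+ 2 * once_gf q.+2 0 = cheb_sum X q.
Proof.
elim: q => [|q IHq]; first by rewrite once_gf_20 mulr0.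
rewrite /= -IHq; have PI := av_gf_inc_cheb q.+1; have PJ := av_gf_inc_cheb q.+2.
have eqJ := once_gf_inc q; set J := once_gf q.+3 0 in eqJ *.
have PJ3 : P q.+3 * J =
    X * (once_gf q.+2 0 * P q.+2 * av_gf q.+3 0 + X * P q.+1 * (av_gf q.+3 0 - 1)).
  by rewrite [P q.+3]chebSS mulrBl -PI {1}eqJ; ring.
rewrite expr2 -mulrA PJ3.
transitivity (X * (once_gf q.+2 0 * P q.+2 * (P q.+3 * av_gf q.+3 0) +
  X * P q.+1 * (P q.+3 * av_gf q.+3 0 - P q.+3))); first ring.
by rewrite PJ [P q.+3]chebSS; ring.
Qed.

(** In fractions: the coefficient [1 - x * Ia - x * Ib] of [H] is [Pk / (Pa * Pb)], and the cross
    identities reduce [G - Ib] to [xb * Pa / (Pk * Pb)] and [G - Ia] to [xa * Pb / (Pk * Pa)]. *)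
Lemma once_desc_solve (R : comNzRingType) (x Ia Ib G H Ja Jb B Pa Pa1 Pb Pb1 Pk Pk1 xa xb : R) :
  Pa * Ia = Pa1 -> Pb * Ib = Pb1 -> Pk * G = Pk1 ->
  Pa * Pb - x * Pa1 * Pb - x * Pa * Pb1 = Pk ->
  Pk1 * Pb - Pk * Pb1 = xb * Pa -> Pk1 * Pa - Pk * Pa1 = xa * Pb ->
  H = x * (Ja * G + (H - Ja) * Ib + (Ia * H + (G - Ia) * Jb) + x * B) ->
  Pk ^+ 2 * H = x * (xb * (Pa ^+ 2 * Ja) + xa * (Pb ^+ 2 * Jb)) + x ^+ 2 * (Pk * Pa * Pb * B).
Proof.
move=> hIa hIb hG hk hb ha hH.
have -> : Pk ^+ 2 * H = Pk * Pa * Pb * (H - x * Ia * H - x * Ib * H).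
  by rewrite expr2 -{2}hk -hIa -hIb; ring.
have -> : H - x * Ia * H - x * Ib * H = x * (Ja * (G - Ib) + (G - Ia) * Jb + x * B).
  by rewrite {1}hH; ring.
transitivity (x * (Pa * Ja * (Pk * G * Pb - Pk * (Pb * Ib)) +
  Pb * Jb * (Pk * G * Pa - Pk * (Pa * Ia))) + x ^+ 2 * (Pk * Pa * Pb * B)); first ring.
by rewrite hG hIa hIb hb ha; ring.
Qed.

Lemma once_gf_cheb (a b : nat) (B : series rat) :
  once_gf a.+2 b.+1 = X * (once_desc a.+1 b.+1 + X * B) ->
  P (a + b).+3 ^+ 2 * once_gf a.+2 b.+1 =
    X * (X ^+ b.+1 * (P a.+1 ^+ 2 * once_gf a.+1 0) + X ^+ a.+1 * (P b.+1 ^+ 2 * once_gf b.+1 0)) +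
    X ^+ 2 * (P (a + b).+3 * P a.+1 * P b.+1 * B).
Proof.
move=> eqH.
apply: (once_desc_solve (av_gf_inc_cheb a) (av_gf_inc_cheb b) (av_gf_occ_cheb a b) _ _ _ eqH).
- by rewrite -[(a + b).+3]/((a.+1 + b).+2) -chebD [P a.+2]chebSS; ring.
- by rewrite addnC -(cheb_cross X b a.+1) !addnS.
- by rewrite -(cheb_cross X a b.+1) !addnS.
Qed.

Lemma once_gf_occ_cheb (a b : nat) : b != 1%N ->
  P (a + b).+4 ^+ 2 * once_gf a.+3 b.+1 =
    X ^+ b.+2 * cheb_sum X a + X ^+ a.+3 * (P b.+1 ^+ 2 * once_gf b.+1 0) +
    X ^+ 2 * (P b.+1 * P a.+1 * (P (a + b).+3 - P (a + b).+4) +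
              X ^+ a.+2 * P b.+1 * (P b - P b.+1)).
Proof.
move=> b1; rewrite -[(a + b).+4]/((a.+1 + b).+3) (once_gf_cheb (once_gf_occ a b1)) once_gf_inc_cheb.
have PI := av_gf_inc_cheb a.+1; have PK := av_gf_inc_cheb b; have PG := av_gf_occ_cheb a.+1 b.
have cross := cheb_cross X a.+1 b.+1.
rewrite !addnS !addSn in cross PG *.
rewrite [X ^+ b.+2]exprS [X ^+ a.+3]exprS -cross -[in RHS]PK -[in RHS]PI -!PG; ring.
Qed.

(** The case [d = 0] of [cheb_cross]. It trades powers of [y] for [cheb y a] and [cheb y a.+1], to
    which the recurrence reduces later values, so that the closed forms become identities for
    [ring]. *)
Lemma exprX_cheb (R : comNzRingType) (y : R) (a : nat) :
  y ^+ a.+1 = cheb y a.+1 ^+ 2 - (cheb y a.+1 - y * cheb y a) * cheb y a.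
Proof. by rewrite -chebSS -[y ^+ _]mulr1 -[in LHS](cheb0 y) -cheb_cross addn0; ring. Qed.

Lemma once_gf_m1 (a : nat) : P a.+4 ^+ 2 * once_gf a.+3 1 = cheb_sum X a.+2 - X ^+ a.+4.+1.
Proof.
have := @once_gf_occ_cheb a 0 isT; rewrite addn0 once_gf_10 cheb0 cheb1 => ->.
have -> : X ^+ a.+4.+1 = X ^+ 3 * (X * X ^+ a.+1) by rewrite -exprS -exprD.
have -> : X ^+ a.+3 = X * (X * X ^+ a.+1) by rewrite -!exprS.
have -> : X ^+ a.+2 = X * X ^+ a.+1 by rewrite -exprS.
by rewrite /= (exprX_cheb X a) !chebSS; ring.
Qed.

Lemma once_gf_m2 (a : nat) :
  P a.+4.+1 ^+ 2 * P a.+3 * once_gf a.+3 2 =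
  P a.+3 * (cheb_sum X a.+3 - 2 * X ^+ a.+4.+2) - X ^+ a.+4.+2 * P a.+2.
Proof.
have := once_gf_cheb (once_gf_occ2 a); rewrite addn1 once_gf_20 once_gf_inc_cheb => eqH.
have PI := av_gf_inc_cheb a.+1; have PK := av_gf_inc_cheb 1; have PG := av_gf_occ_cheb a.+1 1.
have PJ := av_gf_inc_cheb a.+2; rewrite addn1 in PG.
rewrite mulrAC eqH.
transitivity (X * X ^+ 2 * cheb_sum X a * P a.+3 + X ^+ 2 *
  (P 2 * (P a.+2 * av_gf a.+2 0) * (P a.+4.+1 * av_gf a.+3 2 - P a.+4.+1) * P a.+3 +
   P a.+4.+1 * (P 2 * av_gf 2 0 - P 2) *
   (P a.+3 * av_gf a.+3 0 * P a.+2 - P a.+3 * (P a.+2 * av_gf a.+2 0)))); first ring.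
rewrite PI PK PG PJ /=.
have -> : X ^+ a.+4.+2 = X ^+ 3 * (X * (X * X ^+ a.+1)) by rewrite -!exprS -exprD.
by rewrite (exprX_cheb X a) !chebSS cheb0 cheb1; ring.
Qed.

Lemma once_gf_m3 (a c : nat) :
  P (a + c).+4.+2 ^+ 2 * once_gf a.+3 c.+3 =
  X ^+ c.+3 * cheb_sum X a.+1 + X ^+ a.+2 * cheb_sum X c.+2 - X ^+ (a + c).+4.+3
  + X ^+ 3 * (P (a + c).+4.+1 * P c.+2 * P a.+1).
Proof.
have := @once_gf_occ_cheb a c.+2 isT; rewrite !addnS once_gf_inc_cheb => ->.
have -> : X ^+ (a + c).+4.+3 = X ^+ 5 * (X ^+ a.+1 * X ^+ c.+1).
  by rewrite -!exprD; congr (_ ^+ _); lia.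
have -> : X ^+ c.+4 = X * (X * (X * X ^+ c.+1)) by rewrite -!exprS.
have -> : X ^+ c.+3 = X * (X * X ^+ c.+1) by rewrite -!exprS.
have -> : X ^+ a.+3 = X * (X * X ^+ a.+1) by rewrite -!exprS.
have -> : X ^+ a.+2 = X * X ^+ a.+1 by rewrite -exprS.
(* All values at indices beyond [a + c] reduce to these two, hence to the values at [a], [a.+1], [c]
   and [c.+1]. *)
have eqP2 : P (a + c).+2 = P a.+1 * P c.+1 - X * (P a * P c) by rewrite chebD.
have eqP3 : P (a + c).+3 = P a.+2 * P c.+1 - X * (P a.+1 * P c) by rewrite chebD.
rewrite /= [P (a + c).+4.+2]chebSS [P (a + c).+4.+1]chebSS [P (a + c).+4]chebSS eqP2 eqP3.
by rewrite (exprX_cheb X a) (exprX_cheb X c) !chebSS; ring.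
Qed.

Lemma once_gf_21_series : (1 - 2 * X) * once_gf 2 1 = X ^+ 3.
Proof.
have I1 : av_gf 1 0 = 1 by have := av_gf_inc_cheb 0; rewrite cheb0 cheb1 mul1r.
have eqH := once_gf_21; rewrite /once_desc once_gf_10 I1 in eqH.
by rewrite mulrBl {1}eqH; ring.
Qed.

Lemma once_gf_22_series : (1 - X) * (1 - 3 * X + X ^+ 2) * once_gf 2 2 = X ^+ 3 * (1 + X).
Proof.
have I1 : av_gf 1 0 = 1 by have := av_gf_inc_cheb 0; rewrite cheb0 cheb1 mul1r.
have := av_gf_inc_cheb 1; rewrite chebSS cheb0 cheb1 mulr1 => I2.
have eqH := once_gf_22; rewrite /once_desc once_gf_10 once_gf_20 I1 in eqH.
transitivity ((1 - X) ^+ 2 * once_gf 2 2 - X * (1 - X) * once_gf 2 2 -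
  X * (1 - X) ^+ 2 * once_gf 2 2); first ring.
(* The factor [(1 - X) ^+ 2] lets [av_gf 2 0] occur only through [(1 - X) * av_gf 2 0], which is
   1. *)
have -> : (1 - X) ^+ 2 * once_gf 2 2 = X * ((1 - X) * ((1 - X) * av_gf 2 0) * once_gf 2 2 +
    (1 - X) ^+ 2 * once_gf 2 2 +
    X * (X * ((1 - X) * av_gf 2 0) ^+ 2 + ((1 - X) * av_gf 2 0 - (1 - X)) ^+ 2)).
  by rewrite {1}eqH; ring.
by rewrite I2; ring.
Qed.

(** * The right-hand sides over a field containing a square root of [x] *)

Section ClosedForms.
Variables (K : fieldType) (s : K).
Hypotheses (s_neq0 : s != 0) (two_neq0 : 2 != 0 :> K).
Let y := s ^+ 2.
Let u := (2 * s)^-1.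

Lemma chebU_cheb (j : nat) : chebU j u = cheb y j / s ^+ j.
Proof.
suff: chebU j u = cheb y j / s ^+ j /\ chebU j.+1 u = cheb y j.+1 / s ^+ j.+1 by case.
elim: j => [|j [IH1 IH2]].
  rewrite /= cheb0 cheb1 expr0 divr1 expr1; split=> //; rewrite /u; field.
  by rewrite s_neq0 two_neq0.
split=> //; rewrite chebSS.
have -> : chebU j.+2 u = 2 * u * chebU j.+1 u - chebU j u by [].
rewrite IH1 IH2 /u /y !(exprS s j.+1) !(exprS s j); field.
by rewrite ?expf_neq0 ?s_neq0 ?two_neq0.
Qed.

Lemma sum_chebU (q : nat) :
  y ^+ q.+3 * \sum_(1 <= j < q.+1) chebU j u ^+ 2 = cheb_sum y q.
Proof.
elim: q => [|q IHq]; first by rewrite big_geq // mulr0.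
have -> : cheb_sum y q.+1 = y * cheb_sum y q + y ^+ 3 * cheb y q.+1 ^+ 2 by [].
rewrite big_nat_recr // mulrDr exprS -[in LHS]mulrA IHq; congr (_ + _).
rewrite chebU_cheb.
have -> : y * y ^+ q.+3 = y ^+ 3 * (s ^+ q.+1) ^+ 2.
  by rewrite -exprS -[q.+4]/(3 + q.+1)%N exprD [y ^+ q.+1]exprAC.
have := expf_neq0 q.+1 s_neq0; move: (s ^+ _) (cheb _ _) (y ^+ 3) => v c z v_neq0.
by field.
Qed.

Lemma prefactor (k : nat) : cheb y k != 0 ->
  1 / (4 * u ^+ 2 * chebU k u ^+ 2) = y ^+ k.+1 / cheb y k ^+ 2.
Proof.
move=> Pk; rewrite chebU_cheb /u (exprS y) [y ^+ k]exprAC.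
have four_neq0 : 4 != 0 :> K by rewrite (_ : 4 = 2 * 2) ?mulf_neq0 //; ring.
have := expf_neq0 k s_neq0; move: (s ^+ k) (cheb y k) Pk => v c c_neq0 v_neq0.
by rewrite /y; field; rewrite c_neq0 v_neq0 s_neq0 two_neq0.
Qed.

Lemma rhs_m1 (q : nat) : cheb y q.+2 != 0 ->
  1 / (4 * u ^+ 2 * chebU q.+2 u ^+ 2) *
    (\sum_(1 <= j < (q.+2 - 2).+1) chebU j u ^+ 2 - 1) =
  (cheb_sum y q - y ^+ q.+3) / cheb y q.+2 ^+ 2.
Proof.
move=> Pk; rewrite prefactor // !subSS subn0 -sum_chebU.
by rewrite mulrAC mulrBr mulr1.
Qed.

Lemma rhs_m2 (q : nat) : cheb y q.+3 != 0 -> cheb y q.+1 != 0 ->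
  1 / (4 * u ^+ 2 * chebU q.+3 u ^+ 2) *
    (\sum_(1 <= j < (q.+3 - 2).+1) chebU j u ^+ 2
     - 2 * u * chebU (q.+3 - 3) u / chebU (q.+3 - 2) u - 2) =
  (cheb y q.+1 * (cheb_sum y q.+1 - 2 * y ^+ q.+4) - y ^+ q.+4 * cheb y q) /
    (cheb y q.+3 ^+ 2 * cheb y q.+1).
Proof.
move=> Pk Pq; rewrite prefactor // !subSS !subn0 -sum_chebU.
have -> : 2 * u * chebU q u / chebU q.+1 u = cheb y q / cheb y q.+1.
  rewrite !chebU_cheb exprS /u; have := expf_neq0 q s_neq0.
  move: (s ^+ q) (cheb y q) (cheb y q.+1) Pq => v c d d_neq0 v_neq0.
  by field; rewrite s_neq0 two_neq0 d_neq0 v_neq0.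
move: (\sum_(_ <= _ < _) _) => S.
move: (cheb y q.+3) (cheb y q.+1) (cheb y q) (y ^+ q.+4) Pk Pq => c d e z c_neq0 d_neq0.
by field; rewrite c_neq0 d_neq0.
Qed.

Lemma rhs_m3 (p m : nat) : cheb y (p.+2 + m.+1) != 0 ->
  1 / (4 * u ^+ 2 * chebU (p.+2 + m.+1) u ^+ 2) *
    (\sum_(1 <= j < p.+1) chebU j u ^+ 2 + \sum_(1 <= j < m.+1) chebU j u ^+ 2 - 1
     + chebU (p + m).+2 u * chebU m u * chebU p u) =
  (y ^+ m.+1 * cheb_sum y p + y ^+ p.+1 * cheb_sum y m - y ^+ (p + m).+4
   + y ^+ 3 * (cheb y (p + m).+2 * cheb y m * cheb y p)) / cheb y (p.+2 + m.+1) ^+ 2.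
Proof.
move=> Pk; rewrite prefactor // -!sum_chebU !chebU_cheb.
(* The power in the prefactor is factored in a different way for each of the four terms, according
   to what its sum or product of [chebU] absorbs. *)
have e1 : y ^+ (p.+2 + m.+1).+1 = y ^+ m.+1 * y ^+ p.+3.
  by rewrite -exprD; congr (_ ^+ _); lia.
have e2 : y ^+ (p.+2 + m.+1).+1 = y ^+ p.+1 * y ^+ m.+3.
  by rewrite -exprD; congr (_ ^+ _); lia.
have e3 : y ^+ (p.+2 + m.+1).+1 = y ^+ (p + m).+4 by congr (_ ^+ _); lia.
have e4 : y ^+ (p.+2 + m.+1).+1 = y ^+ 3 * (s ^+ (p + m).+2 * s ^+ m * s ^+ p).
  by rewrite /y -!exprM -!exprD; congr (_ ^+ _); lia.
rewrite [_ / _ * _]mulrAC; congr (_ / _).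
rewrite mulrDr mulrBr mulrDr mulr1.
congr (_ + _ - _ + _); [by rewrite e1 -mulrA | by rewrite e2 -mulrA | exact: e3 |].
rewrite e4; have := expf_neq0 p s_neq0; have := expf_neq0 m s_neq0.
have := expf_neq0 (p + m).+2 s_neq0.
move: (s ^+ (p + m).+2) (s ^+ m) (s ^+ p) (cheb y (p + m).+2) (cheb y m) (cheb y p) (y ^+ 3).
by move=> v1 v2 v3 c1 c2 c3 z v1_neq0 v2_neq0 v3_neq0; field; rewrite v1_neq0 v2_neq0 v3_neq0.
Qed.

End ClosedForms.

(** * Transfer to [Q(s)] and conclusion *)

Definition subst_x (p : {poly rat}) : {fraction {poly rat}} := tofrac (p \Po 'X^2).

HB.instance Definition _ := GRing.RMorphism.copy subst_x (@tofrac _ \o comp_poly 'X^2).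

Lemma subst_xX : subst_x 'X = x.
Proof. by rewrite /subst_x comp_polyX rmorphXn. Qed.

Lemma subst_x_neq0 (p : {poly rat}) : p`_0 != 0 -> subst_x p != 0.
Proof.
apply: contraNneq => /eqP; rewrite tofrac_eq0 => /eqP/(congr1 (fun q => q.[0])).
by rewrite horner_comp hornerXn expr0n /= !horner_coef0 coef0 => ->.
Qed.

Lemma sqrtx_neq0 : sqrtx != 0.
Proof. by rewrite tofrac_eq0 polyX_eq0. Qed.

Lemma two_frac_neq0 : 2 != 0 :> {fraction {poly rat}}.
Proof. by rewrite -(rmorph_nat (@tofrac _)) tofrac_eq0 -polyC1 -polyCMn polyC_eq0. Qed.

(** Polynomials mediate between the two worlds: [series_of_poly] and [subst_x] are both ring
    morphisms, so [p] and [q] are compared with the series on one side and with [F] on the other. *)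
Lemma is_gf_frac (a : nat -> nat) (f : series rat) (p q : {poly rat})
    (F : {fraction {poly rat}}) :
  f = (fun n => (a n)%:R) -> q`_0 = 1 -> series_of_poly q * f = series_of_poly p ->
  F = subst_x p / subst_x q -> is_gf a F.
Proof.
move=> -> q0 eq_qa ->; exists p, q; split=> //.
  by apply/eqP=> q00; move: q0; rewrite q00 coef0 => /esym/eqP; rewrite oner_eq0.
by move=> n; have := congr1 (fun g : series rat => g n) eq_qa; rewrite coef_seriesM.
Qed.

Lemma coef0_cheb (n : nat) : (cheb ('X : {poly rat}) n)`_0 = 1.
Proof. by have := cheb_series0 n; rewrite -rmorph_cheb. Qed.

Lemma cheb_x_neq0 (n : nat) : cheb x n != 0.
Proof. by rewrite -subst_xX -rmorph_cheb subst_x_neq0 // coef0_cheb oner_neq0. Qed.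

Theorem theorem5p12 :
  ((forall k : nat, (4 <= k)%N ->
      is_gf (h (shift_pattern k 1))
        (1 / (4 * t ^+ 2 * chebU k t ^+ 2) *
           (\sum_(1 <= j < (k - 2).+1) chebU j t ^+ 2 - 1)))
   /\ is_gf (h (shift_pattern 3 1)) (x ^+ 3 / (1 - 2 * x)))
  /\
  ((forall k : nat, (5 <= k)%N ->
      is_gf (h (shift_pattern k 2))
        (1 / (4 * t ^+ 2 * chebU k t ^+ 2) *
           (\sum_(1 <= j < (k - 2).+1) chebU j t ^+ 2
            - 2 * t * chebU (k - 3) t / chebU (k - 2) t - 2)))
   /\ is_gf (h (shift_pattern 4 2))
        (x ^+ 3 * (1 + x) / ((1 - x) * (1 - 3 * x + x ^+ 2))))
  /\
  (forall k m : nat, (6 <= k)%N -> (3 <= m)%N -> (2 * m <= k)%N ->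
      is_gf (h (shift_pattern k m))
        (1 / (4 * t ^+ 2 * chebU k t ^+ 2) *
           (\sum_(1 <= j < (k - m - 2).+1) chebU j t ^+ 2
            + \sum_(1 <= j < (m - 1).+1) chebU j t ^+ 2
            - 1
            + chebU (k - 1) t * chebU (m - 1) t * chebU (k - m - 2) t))).
Proof.
have subE := (rmorphXn, rmorph_cheb, rmorph_cheb_sum, rmorphB, rmorphD, rmorphM,
  rmorph1, rmorph_nat).
have subX : (subst_x : {rmorphism {poly rat} -> {fraction {poly rat}}}) 'X = x := subst_xX.
split; [split|split; [split|]].
- case=> [|[|[|[|a]]]] // _; apply: (@is_gf_frac _ (once_gf a.+3 1)
    (cheb_sum 'X a.+2 - 'X ^+ a.+4.+1) (cheb 'X a.+4 ^+ 2)).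
  + exact: (@once_gf_h a.+4 1 isT).
  + by rewrite coef0M coef0_cheb mulr1.
  + by rewrite !subE once_gf_m1.
  + by rewrite (rhs_m1 sqrtx_neq0 two_frac_neq0) ?cheb_x_neq0 // !subE !subX.
- apply: (@is_gf_frac _ (once_gf 2 1) ('X ^+ 3) (1 - 2 * 'X)).
  + exact: (@once_gf_h 3 1 isT).
  + by rewrite coefB coef1 coef0M coefX mulr0 subr0.
  + by rewrite !subE once_gf_21_series.
  + by rewrite !subE !subX.
- case=> [|[|[|[|[|a]]]]] // _; apply: (@is_gf_frac _ (once_gf a.+3 2)
    (cheb 'X a.+3 * (cheb_sum 'X a.+3 - 2 * 'X ^+ a.+4.+2) - 'X ^+ a.+4.+2 * cheb 'X a.+2)
    (cheb 'X a.+4.+1 ^+ 2 * cheb 'X a.+3)).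
  + exact: (@once_gf_h a.+4.+1 2 isT).
  + by rewrite !coef0M !coef0_cheb !mulr1.
  + by rewrite !subE once_gf_m2.
  + by rewrite (rhs_m2 sqrtx_neq0 two_frac_neq0) ?cheb_x_neq0 // !subE !subX.
- apply: (@is_gf_frac _ (once_gf 2 2) ('X ^+ 3 * (1 + 'X)) ((1 - 'X) * (1 - 3 * 'X + 'X ^+ 2))).
  + exact: (@once_gf_h 4 2 isT).
  + by rewrite coef0M !(coefB, coefD, coef0M, coef1, coefX, mulr0, subr0, addr0) mulr1.
  + by rewrite !subE once_gf_22_series.
  + by rewrite !subE !subX.
move=> k m _ m_ge3 le_2mk.
have [c defm] : exists c, m = c.+3 by exists (m - 3)%N; lia.
(* From [3 <= m] and [2 * m <= k] the upper block also has length [k - m] at least three. *)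
have [a defk] : exists a, k = (a.+3 + c.+3)%N by exists (k - m - 3)%N; lia.
have -> : (k - m - 2 = a.+1)%N by lia.
have -> : (k - 1 = (a.+1 + c.+2).+2)%N by lia.
rewrite {}defk {}defm subn1 [c.+3.-1]/= in m_ge3 le_2mk *.
apply: (@is_gf_frac _ (once_gf a.+3 c.+3)
  ('X ^+ c.+3 * cheb_sum 'X a.+1 + 'X ^+ a.+2 * cheb_sum 'X c.+2 - 'X ^+ (a + c).+4.+3
   + 'X ^+ 3 * (cheb 'X (a + c).+4.+1 * cheb 'X c.+2 * cheb 'X a.+1))
  (cheb 'X (a + c).+4.+2 ^+ 2)).
- by rewrite -once_gf_h ?leq_addl // addnK.
- by rewrite coef0M coef0_cheb mulr1.
- by rewrite !subE once_gf_m3.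
rewrite (rhs_m3 sqrtx_neq0 two_frac_neq0) ?cheb_x_neq0 // !subE !subX.
by rewrite !(addnS, addSn).
Qed.
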